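(* Let $\mathcal{Z}(z)=\sum_{n\ge1}Z_nz^n$ and $\phi(z)=\sum_{k\ge0}\omega_kz^k$ be power series with non-negative coefficients related by the equation $\mathcal{Z}(z)=z\,\phi(\mathcal{Z}(z))$. Suppose that $\omega_0>0$ and $\omega_k>0$ for at least one $k\ge2$, and let $d$ denote the greatest common divisor of all $k$ with $\omega_k>0$. (It is known that $Z_n=0$ if $n-1$ is not a multiple of $d$, and $Z_n>0$ if $n\equiv1\bmod d$ is large enough.) Suppose that $\mathcal{Z}(z)$ has non-zero radius of convergence $\rho_{\mathcal{Z}}$. Then $$\frac1{Z_n}\sum_{i+j=n+1}Z_iZ_j\ \longrightarrow\ \frac{2\,\mathcal{Z}(\rho_{\mathcal{Z}})}{\rho_{\mathcal{Z}}}\qquad\text{as } n\to\infty,\ n\equiv1\bmod d.$$ Consequently, the shifted series $\mathcal{Z}(z)/z$ belongs to the class $\mathscr{S}_d$.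
   Context: Class $\mathscr{S}_d$ ($d\ge1$ an integer): a power series $g(z)=\sum_{n\ge0}g_nz^n$ with non-negative coefficients and radius of convergence $\rho>0$ belongs to $\mathscr{S}_d$ if $g_n=0$ whenever $d\nmid n$, and, as $n\to\infty$ with $n\equiv0\bmod d$, $g_n/g_{n+d}\to\rho^d$ and $\frac1{g_n}\sum_{i+j=n}g_ig_j\to2g(\rho)<\infty$. The following facts are known from the literature on simply generated trees (Janson 2012) under the hypotheses of the claim: $\mathcal{Z}(\rho_{\mathcal{Z}})<\infty$, and $Z_n/Z_{n+d}\to\rho_{\mathcal{Z}}^d$ and $Z_n^{1/n}\to1/\rho_{\mathcal{Z}}$ as $n\to\infty$ with $n\equiv1\bmod d$. *)

(* Defs.v *)
From Stdlib Require Import Reals Arith.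
From Coquelicot Require Import Coquelicot.
Open Scope R_scope.

(** Formal power series are coefficient sequences [nat -> R]. *)

Definition PS_pow (a : nat -> R) (k : nat) : nat -> R :=
  Nat.iter k (PS_mult a) (fun n => if Nat.eqb n 0 then 1 else 0).

(** Coefficients of the formal composition [b(a(z))], for [a 0 = 0]: then
    [a(z)^k] has no term of degree [< k], so that only the indices [k <= n]
    contribute to the coefficient of [z^n]. *)
Definition PS_comp (b a : nat -> R) : nat -> R :=
  fun n => sum_f_R0 (fun k => b k * PS_pow a k n) n.

Definition is_support_gcd (a : nat -> R) (d : nat) : Prop :=
  (forall k, 0 < a k -> Nat.divide d k) /\
  (forall e, (forall k, 0 < a k -> Nat.divide e k) -> Nat.divide e d).

(** [n -> oo] along [n] congruent to [r] modulo [d]. *)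
Definition eventually_mod (r d : nat) : (nat -> Prop) -> Prop :=
  within (fun n => (n mod d = r mod d)%nat) eventually.

(** The class S_d.  The limit of the ratios being [rho ^ d > 0], [g n] is
    nonzero for all large multiples [n] of [d], so the divisions are genuine
    for large [n]. *)
Definition in_class_S (d : nat) (g : nat -> R) : Prop :=
  (1 <= d)%nat /\
  (forall n, 0 <= g n) /\
  exists rho : R,
    CV_radius g = Finite rho /\ 0 < rho /\
    (forall n, ~ Nat.divide d n -> g n = 0) /\
    filterlim (fun n => g n / g (n + d)%nat)
      (eventually_mod 0 d) (locally (rho ^ d)) /\
    ex_pseries g rho /\
    filterlim (fun n => / g n * PS_mult g g n)
      (eventually_mod 0 d) (locally (2 * PSeries g rho)).

(* Main.v *)
Require Import Defs.
From Stdlib Require Import Reals Arith.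
From Coquelicot Require Import Coquelicot.
From Stdlib Require Import Lra Lia Psatz Classical FunctionalExtensionality.
Open Scope R_scope.

(** [Z n] is the weight of the simply generated trees with [n] vertices.  Put
    [tau = Z(rho)] and [b(z) = 1 / (1 - z phi'(Z(z)))].  Differentiating
    [Z = z phi(Z)] gives [z Z' = Z b], that is [n Z_n = sum_i Z_i b_(n-i)].

    Fix [s] with [Z_s > 0].  The average number of fringe subtrees of size [s]
    in a tree of size [n] is [e_n = Z_s b_(n-s) / Z_n].  Give each of them a
    weight [exp t]; by Jensen's inequality the weight of the trees of size [n]
    becomes at least [Z_n exp (t e_n)], and it is at most [tau r^(-n)] as soon as
    [r phi(tau) + (exp t - 1) Z_s r^s <= tau].  Supermultiplicativity gives
    [Z_n >= c q^n] for every [q < 1 / rho], and letting [t] tend to [0] from both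
    sides yields [e_n / n -> Z_s rho^s / tau], so
    [b_(n-s) / (n Z_n) -> rho^s / tau].

    Comparing two sizes [s] and [s + d] gives [Z_n / Z_(n+d) -> rho^d].  The case
    [s = 1] gives [b_(j-1) ~ (rho / tau) j Z_j], and substituting this in the sum
    above, [n Z_n ~ (rho / tau) sum_(i+j=n+1) j Z_i Z_j], where by symmetry the
    last sum is [(n + 1) / 2] times [sum_(i+j=n+1) Z_i Z_j]. *)

Local Notation "a ** b" := (PS_mult a b) (at level 40, left associativity).

(** * Formal power series *)

Definition PS_one (n : nat) : R := if Nat.eqb n 0 then 1 else 0.

Definition PS_mono (s : nat) (c : R) (n : nat) : R := if Nat.eqb n s then c else 0.

(** The Euler operator [z d/dz]; it preserves degrees, so that its product rule needs no index
    shift. *)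
Definition PS_theta (a : nat -> R) (n : nat) : R := INR n * a n.

Lemma sum_f_R0_S_l (f : nat -> R) (n : nat) :
  sum_f_R0 f (S n) = f 0%nat + sum_f_R0 (fun i => f (S i)) n.
Proof. rewrite decomp_sum by lia; reflexivity. Qed.

Lemma sum_f_R0_mono (f : nat -> R) (m n : nat) :
  (forall i, 0 <= f i) -> (m <= n)%nat -> sum_f_R0 f m <= sum_f_R0 f n.
Proof.
  intros H; induction 1 as [|n _ IH]; simpl; [lra|].
  specialize (H (S n)); lra.
Qed.

Lemma sum_f_R0_term (f : nat -> R) (i n : nat) :
  (forall i, 0 <= f i) -> (i <= n)%nat -> f i <= sum_f_R0 f n.
Proof.
  intros H Hi; apply Rle_trans with (sum_f_R0 f i); [|now apply sum_f_R0_mono].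
  destruct i as [|i]; simpl; [lra|].
  pose proof (cond_pos_sum f i H); lra.
Qed.

Lemma sum_f_R0_extend (f : nat -> R) (m n : nat) :
  (m <= n)%nat -> (forall i, (m < i)%nat -> f i = 0) ->
  sum_f_R0 f n = sum_f_R0 f m.
Proof.
  intros Hmn H; induction Hmn as [|n Hmn IH]; simpl; [reflexivity|].
  rewrite IH, H by lia; ring.
Qed.

Lemma PS_mult_S_l (a b : nat -> R) (n : nat) :
  (a ** b) (S n) = a 0%nat * b (S n) + ((fun i => a (S i)) ** b) n.
Proof. unfold PS_mult; rewrite sum_f_R0_S_l; reflexivity. Qed.

Lemma PS_mult_S_r (a b : nat -> R) (n : nat) :
  (a ** b) (S n) = (a ** (fun i => b (S i))) n + a (S n) * b 0%nat.
Proof.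
  unfold PS_mult; simpl; f_equal; [|now rewrite Nat.sub_diag].
  apply sum_eq; intros i Hi.
  destruct i; [now rewrite Nat.sub_0_r|].
  now replace (n - i)%nat with (S (n - S i)) by lia.
Qed.

Lemma PS_mult_eq (a a' b b' : nat -> R) (n : nat) :
  (forall i, (i <= n)%nat -> a i = a' i) -> (forall i, (i <= n)%nat -> b i = b' i) ->
  (a ** b) n = (a' ** b') n.
Proof.
  intros Ha Hb; apply sum_eq; intros i Hi; rewrite Ha, Hb by lia; reflexivity.
Qed.

Lemma PS_mult_plus_l (a a' b : nat -> R) (n : nat) :
  ((fun i => a i + a' i) ** b) n = (a ** b) n + (a' ** b) n.
Proof.
  unfold PS_mult; rewrite <- plus_sum; apply sum_eq; intros; ring.
Qed.

Lemma PS_mult_scal_l (c : R) (a b : nat -> R) (n : nat) :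
  ((fun i => c * a i) ** b) n = c * (a ** b) n.
Proof.
  unfold PS_mult; rewrite scal_sum; apply sum_eq; intros; ring.
Qed.

Lemma PS_mult_comm (a b : nat -> R) : a ** b = b ** a.
Proof.
  extensionality n; revert a b; induction n as [|n IH]; intros a b.
  - unfold PS_mult; simpl; ring.
  - rewrite PS_mult_S_l, PS_mult_S_r, IH; ring.
Qed.

Lemma PS_mult_plus_r (a b b' : nat -> R) (n : nat) :
  (a ** (fun i => b i + b' i)) n = (a ** b) n + (a ** b') n.
Proof.
  rewrite PS_mult_comm, PS_mult_plus_l; f_equal; now rewrite PS_mult_comm.
Qed.

Lemma PS_mult_scal_r (c : R) (a b : nat -> R) (n : nat) :
  (a ** (fun i => c * b i)) n = c * (a ** b) n.
Proof. now rewrite PS_mult_comm, PS_mult_scal_l, PS_mult_comm. Qed.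

Lemma PS_mult_assoc (a b c : nat -> R) : a ** (b ** c) = a ** b ** c.
Proof.
  extensionality n; revert a b c; induction n as [|n IH]; intros a b c.
  - unfold PS_mult; simpl; ring.
  - rewrite !PS_mult_S_l.
    rewrite (PS_mult_eq (fun i => (a ** b) (S i))
      (fun i => a 0%nat * b (S i) + ((fun j => a (S j)) ** b) i) c c)
      by (intros; auto using PS_mult_S_l).
    rewrite PS_mult_plus_l, PS_mult_scal_l, <- IH.
    change ((a ** b) 0%nat) with (a 0%nat * b 0%nat).
    replace (fun i => (b ** c) (S i))
      with (fun i => b 0%nat * c (S i) + ((fun j => b (S j)) ** c) i)
      by (extensionality i; symmetry; apply PS_mult_S_l).
    ring.
Qed.

Lemma PS_mult_one_l (a : nat -> R) : PS_one ** a = a.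
Proof.
  extensionality n; destruct n as [|n].
  - unfold PS_mult, PS_one; simpl; ring.
  - rewrite PS_mult_S_l; unfold PS_mult, PS_one at 1; simpl.
    rewrite sum_eq_R0; [ring|intros; unfold PS_one; simpl; ring].
Qed.

Lemma PS_mult_mono (s : nat) (c : R) (b : nat -> R) (n : nat) :
  (PS_mono s c ** b) n = if Nat.ltb n s then 0 else c * b (n - s)%nat.
Proof.
  revert n; induction s as [|s IH]; intros n.
  - change (Nat.ltb n 0) with false; rewrite Nat.sub_0_r.
    replace (b n) with ((PS_one ** b) n) by (now rewrite PS_mult_one_l).
    rewrite <- PS_mult_scal_l; apply PS_mult_eq; [|reflexivity].
    intros [|i] _; unfold PS_mono, PS_one; simpl; ring.
  - destruct n as [|n].
    + unfold PS_mult, PS_mono; simpl; ring.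
    + rewrite PS_mult_S_l; change (PS_mono (S s) c 0) with 0.
      replace (fun i => PS_mono (S s) c (S i)) with (PS_mono s c) by reflexivity.
      rewrite IH; change (Nat.ltb (S n) (S s)) with (Nat.ltb n s); simpl; ring.
Qed.

Lemma PS_mult_ge0 (a b : nat -> R) (n : nat) :
  (forall i, 0 <= a i) -> (forall i, 0 <= b i) -> 0 <= (a ** b) n.
Proof.
  intros Ha Hb; apply cond_pos_sum; intros; apply Rmult_le_pos; auto.
Qed.

Lemma PS_theta_mult (a b : nat -> R) (n : nat) :
  PS_theta (a ** b) n = (PS_theta a ** b) n + (a ** PS_theta b) n.
Proof.
  unfold PS_theta, PS_mult; rewrite scal_sum, <- plus_sum.
  apply sum_eq; intros i Hi; rewrite minus_INR by lia; ring.
Qed.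

Lemma PS_pow_S (a : nat -> R) (k : nat) : PS_pow a (S k) = a ** PS_pow a k.
Proof. reflexivity. Qed.

Lemma PS_pow_ge0 (a : nat -> R) (k n : nat) :
  (forall i, 0 <= a i) -> 0 <= PS_pow a k n.
Proof.
  intros Ha; revert n; induction k as [|k IH]; intros n.
  - unfold PS_pow; simpl; destruct (Nat.eqb n 0); lra.
  - rewrite PS_pow_S; apply PS_mult_ge0; auto.
Qed.

Lemma PS_pow_low (a : nat -> R) (k n : nat) :
  a 0%nat = 0 -> (n < k)%nat -> PS_pow a k n = 0.
Proof.
  intros Ha; revert n; induction k as [|k IH]; intros n Hn; [lia|].
  rewrite PS_pow_S; apply sum_eq_R0; intros [|i] Hi.
  - rewrite Ha; ring.
  - rewrite IH by lia; ring.
Qed.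

Lemma PS_pow_eq (a a' : nat -> R) (k n : nat) :
  (forall i, (i <= n)%nat -> a i = a' i) -> PS_pow a k n = PS_pow a' k n.
Proof.
  revert n; induction k as [|k IH]; intros n H; [reflexivity|].
  rewrite !PS_pow_S; apply PS_mult_eq; [exact H|].
  intros i Hi; apply IH; intros; apply H; lia.
Qed.

Lemma PS_comp_eq (w a a' : nat -> R) (n : nat) :
  (forall i, (i <= n)%nat -> a i = a' i) -> PS_comp w a n = PS_comp w a' n.
Proof.
  intros H; apply sum_eq; intros k _; now rewrite (PS_pow_eq a a').
Qed.

Lemma PS_comp_ge0 (w a : nat -> R) (n : nat) :
  (forall k, 0 <= w k) -> (forall i, 0 <= a i) -> 0 <= PS_comp w a n.
Proof.
  intros Hw Ha; apply cond_pos_sum; intros k; apply Rmult_le_pos; auto.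
  now apply PS_pow_ge0.
Qed.

(** The truncation in [PS_comp] varies with the coefficient; a common bound [m] lets sums be
    exchanged. *)
Lemma PS_comp_extend (w a : nat -> R) (m n : nat) :
  a 0%nat = 0 -> (n <= m)%nat ->
  PS_comp w a n = sum_f_R0 (fun k => w k * PS_pow a k n) m.
Proof.
  intros Ha Hm; symmetry; apply sum_f_R0_extend; [exact Hm|].
  intros k Hk; rewrite PS_pow_low by auto; ring.
Qed.

Lemma PS_mult_sum_l (f : nat -> nat -> R) (b : nat -> R) (m n : nat) :
  ((fun i => sum_f_R0 (fun k => f k i) m) ** b) n = sum_f_R0 (fun k => (f k ** b) n) m.
Proof.
  induction m as [|m IH]; simpl; [reflexivity|].
  now rewrite <- IH, <- PS_mult_plus_l.
Qed.

Lemma PS_mult_comp (w a b : nat -> R) (m n : nat) :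
  a 0%nat = 0 -> (n <= m)%nat ->
  (PS_comp w a ** b) n = sum_f_R0 (fun k => w k * (PS_pow a k ** b) n) m.
Proof.
  intros Ha Hm.
  rewrite (PS_mult_eq _ (fun i => sum_f_R0 (fun k => w k * PS_pow a k i) m) b b);
    [|intros; apply PS_comp_extend; auto; lia|auto].
  rewrite PS_mult_sum_l; apply sum_eq; intros; apply PS_mult_scal_l.
Qed.

(** The series [1 / (1 - p)], for [p 0 = 0]. *)
Definition PS_geom (p : nat -> R) : nat -> R := PS_comp (fun _ => 1) p.

Lemma PS_geom_eq (p : nat -> R) (n : nat) :
  p 0%nat = 0 -> PS_geom p n = PS_one n + (p ** PS_geom p) n.
Proof.
  intros Hp; unfold PS_geom.
  rewrite (PS_comp_extend _ p (S n)) by (auto; lia).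
  rewrite sum_f_R0_S_l, PS_mult_comm, (PS_mult_comp _ p p n n) by auto.
  f_equal; [unfold PS_pow, PS_one; simpl; ring|].
  apply sum_eq; intros k _; now rewrite PS_pow_S, PS_mult_comm.
Qed.

(** The derivative [d/dx a^k], for [e = d/dx a]. *)
Fixpoint PS_dpow (a e : nat -> R) (k : nat) : nat -> R :=
  match k with
  | O => fun _ => 0
  | S k => fun n => (e ** PS_pow a k) n + (a ** PS_dpow a e k) n
  end.

Lemma PS_dpow_S (a e : nat -> R) (k n : nat) :
  PS_dpow a e (S k) n = INR (S k) * (PS_pow a k ** e) n.
Proof.
  revert n; induction k as [|k IH]; intros n.
  - simpl; rewrite (PS_mult_comm e).
    enough ((a ** (fun _ => 0)) n = 0) by lra.
    apply sum_eq_R0; intros; ring.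
  - change (PS_dpow a e (S (S k)) n)
      with ((e ** PS_pow a (S k)) n + (a ** PS_dpow a e (S k)) n).
    rewrite (PS_mult_eq a a _ (fun i => INR (S k) * (PS_pow a k ** e) i)) by auto.
    rewrite PS_mult_scal_r, PS_mult_assoc, <- PS_pow_S, (PS_mult_comm e).
    rewrite (S_INR (S k)); ring.
Qed.

Lemma PS_theta_pow (a : nat -> R) (k n : nat) :
  PS_theta (PS_pow a k) n = PS_dpow a (PS_theta a) k n.
Proof.
  revert n; induction k as [|k IH]; intros n.
  - unfold PS_theta, PS_pow; destruct n; simpl; ring.
  - rewrite PS_pow_S, PS_theta_mult; simpl; f_equal.
    apply PS_mult_eq; auto.
Qed.

Lemma sum_PS_dpow (w a e : nat -> R) (n : nat) :
  a 0%nat = 0 -> e 0%nat = 0 ->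
  sum_f_R0 (fun k => w k * PS_dpow a e k n) n
  = (PS_comp (PS_derive w) a ** e) n.
Proof.
  intros Ha He; rewrite (PS_mult_comp _ a e n n) by auto.
  destruct n as [|n].
  - unfold PS_mult; simpl; rewrite He; ring.
  - rewrite sum_f_R0_S_l, (tech5 _ n).
    (* The derivative shifts [k] by one and leaves the spare term [k = S n]. It vanishes:
       [PS_pow a (S n)] starts in degree [S n] and [e] in degree 1. *)
    replace ((PS_pow a (S n) ** e) (S n)) with 0.
    + simpl (PS_dpow a e 0 (S n)); rewrite Rmult_0_r, Rmult_0_r, Rplus_0_l, Rplus_0_r.
      apply sum_eq; intros k _; rewrite PS_dpow_S; unfold PS_derive; ring.
    + symmetry; apply sum_eq_R0; intros i Hi.
      destruct (Nat.eq_dec i (S n)) as [->|Hn].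
      * rewrite Nat.sub_diag, He; ring.
      * rewrite PS_pow_low by (auto; lia); ring.
Qed.

Lemma PS_theta_comp (w a : nat -> R) (n : nat) :
  a 0%nat = 0 ->
  PS_theta (PS_comp w a) n = (PS_comp (PS_derive w) a ** PS_theta a) n.
Proof.
  intros Ha; rewrite <- sum_PS_dpow; [|exact Ha|unfold PS_theta; simpl; ring].
  unfold PS_theta at 1; unfold PS_comp; rewrite scal_sum.
  apply sum_eq; intros k _; rewrite <- PS_theta_pow; unfold PS_theta; ring.
Qed.

(** * Truncated values of power series *)

Definition PS_eval (N : nat) (a : nat -> R) (r : R) : R :=
  sum_f_R0 (fun n => a n * r ^ n) N.

Lemma PS_eval_S (N : nat) (a : nat -> R) (r : R) :
  PS_eval (S N) a r = a 0%nat + r * PS_eval N (fun i => a (S i)) r.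
Proof.
  unfold PS_eval; rewrite sum_f_R0_S_l, scal_sum; simpl; f_equal; [ring|].
  apply sum_eq; intros; ring.
Qed.

Lemma PS_eval_ge0 (N : nat) (a : nat -> R) (r : R) :
  0 <= r -> (forall i, 0 <= a i) -> 0 <= PS_eval N a r.
Proof.
  intros Hr Ha; apply cond_pos_sum; intros; apply Rmult_le_pos; auto using pow_le.
Qed.

Lemma PS_eval_mono (M N : nat) (a : nat -> R) (r : R) :
  0 <= r -> (forall i, 0 <= a i) -> (M <= N)%nat -> PS_eval M a r <= PS_eval N a r.
Proof.
  intros Hr Ha; apply sum_f_R0_mono; intros; apply Rmult_le_pos; auto using pow_le.
Qed.

Lemma PS_eval_plus (N : nat) (a b : nat -> R) (r : R) :
  PS_eval N (fun i => a i + b i) r = PS_eval N a r + PS_eval N b r.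
Proof. unfold PS_eval; rewrite <- plus_sum; apply sum_eq; intros; ring. Qed.

Lemma PS_eval_scal (N : nat) (c : R) (a : nat -> R) (r : R) :
  PS_eval N (fun i => c * a i) r = c * PS_eval N a r.
Proof. unfold PS_eval; rewrite scal_sum; apply sum_eq; intros; ring. Qed.

Lemma PS_eval_ext (N : nat) (a b : nat -> R) (r : R) :
  (forall i, (i <= N)%nat -> a i = b i) -> PS_eval N a r = PS_eval N b r.
Proof. intros H; apply sum_eq; intros; now rewrite H. Qed.

Lemma PS_eval_sum (f : nat -> nat -> R) (m N : nat) (r : R) :
  PS_eval N (fun i => sum_f_R0 (fun k => f k i) m) r
  = sum_f_R0 (fun k => PS_eval N (f k) r) m.
Proof.
  induction m as [|m IH]; simpl; [reflexivity|].
  now rewrite <- IH, <- PS_eval_plus.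
Qed.

Lemma PS_eval_mult_S (N : nat) (a b : nat -> R) (r : R) :
  PS_eval (S N) (a ** b) r
  = a 0%nat * PS_eval (S N) b r + r * PS_eval N ((fun i => a (S i)) ** b) r.
Proof.
  rewrite PS_eval_S.
  rewrite (PS_eval_ext N _ (fun i => a 0%nat * b (S i) + ((fun j => a (S j)) ** b) i))
    by (intros; apply PS_mult_S_l).
  rewrite PS_eval_plus, PS_eval_scal, (PS_eval_S N b).
  unfold PS_mult at 1; simpl; ring.
Qed.

(** The pairs of degrees with sum at most [N] lie in the square of side [N]. *)
Lemma PS_eval_mult_le (N : nat) (a b : nat -> R) (r : R) :
  0 <= r -> (forall i, 0 <= a i) -> (forall i, 0 <= b i) ->
  PS_eval N (a ** b) r <= PS_eval N a r * PS_eval N b r.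
Proof.
  intros Hr Ha Hb; revert a Ha; induction N as [|N IH]; intros a Ha.
  - unfold PS_eval, PS_mult; simpl; lra.
  - rewrite PS_eval_mult_S, (PS_eval_S N a).
    specialize (IH (fun i => a (S i)) (fun i => Ha (S i))).
    pose proof (PS_eval_mono N (S N) b r Hr Hb ltac:(lia)).
    pose proof (PS_eval_ge0 N (fun i => a (S i)) r Hr (fun i => Ha (S i))).
    rewrite Rmult_plus_distr_r; apply Rplus_le_compat_l.
    rewrite Rmult_assoc; apply Rmult_le_compat_l; [exact Hr|].
    eapply Rle_trans; [apply IH|]; now apply Rmult_le_compat_l.
Qed.

(** Conversely, degrees at most [N] and at most [M] have a sum at most [N + M]. *)
Lemma PS_eval_mult_ge (N M : nat) (a b : nat -> R) (r : R) :
  0 <= r -> (forall i, 0 <= a i) -> (forall i, 0 <= b i) ->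
  PS_eval N a r * PS_eval M b r <= PS_eval (N + M) (a ** b) r.
Proof.
  intros Hr Ha Hb; revert a Ha; induction N as [|N IH]; intros a Ha.
  - unfold PS_eval at 1; simpl; rewrite Rmult_1_r.
    unfold PS_eval; rewrite scal_sum; apply sum_Rle; intros n _.
    rewrite (Rmult_comm _ (a 0%nat)), <- Rmult_assoc.
    apply Rmult_le_compat_r; [auto using pow_le|].
    apply Rle_trans with (a 0%nat * b (n - 0)%nat); [rewrite Nat.sub_0_r; lra|].
    apply (sum_f_R0_term (fun k => a k * b (n - k)%nat)); [|lia].
    intros; apply Rmult_le_pos; auto.
  - change (S N + M)%nat with (S (N + M)).
    rewrite PS_eval_mult_S, (PS_eval_S N a).
    specialize (IH (fun i => a (S i)) (fun i => Ha (S i))).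
    pose proof (PS_eval_mono M (S (N + M)) b r Hr Hb ltac:(lia)).
    rewrite Rmult_plus_distr_r; apply Rplus_le_compat.
    + now apply Rmult_le_compat_l.
    + rewrite Rmult_assoc; now apply Rmult_le_compat_l.
Qed.

Lemma PS_eval_pow_le (N k : nat) (a : nat -> R) (r : R) :
  0 <= r -> (forall i, 0 <= a i) -> PS_eval N (PS_pow a k) r <= PS_eval N a r ^ k.
Proof.
  intros Hr Ha; induction k as [|k IH].
  - clear; induction N as [|N IH]; unfold PS_eval, PS_pow in *; simpl in *; lra.
  - rewrite PS_pow_S; simpl.
    eapply Rle_trans;
      [apply PS_eval_mult_le; auto using PS_pow_ge0|].
    apply Rmult_le_compat_l; auto using PS_eval_ge0.
Qed.

Lemma PS_eval_pow_ge (N k : nat) (a : nat -> R) (r : R) :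
  0 <= r -> (forall i, 0 <= a i) -> PS_eval N a r ^ k <= PS_eval (k * N) (PS_pow a k) r.
Proof.
  intros Hr Ha; induction k as [|k IH].
  - unfold PS_eval, PS_pow; simpl; lra.
  - rewrite PS_pow_S; simpl.
    eapply Rle_trans; [|apply PS_eval_mult_ge; auto using PS_pow_ge0].
    apply Rmult_le_compat_l; auto using PS_eval_ge0.
Qed.

Lemma PS_eval_comp (N : nat) (w a : nat -> R) (r : R) :
  a 0%nat = 0 ->
  PS_eval N (PS_comp w a) r = sum_f_R0 (fun k => w k * PS_eval N (PS_pow a k) r) N.
Proof.
  intros Ha.
  rewrite (PS_eval_ext N _ (fun i => sum_f_R0 (fun k => w k * PS_pow a k i) N))
    by (intros; apply PS_comp_extend; auto).
  rewrite PS_eval_sum; apply sum_eq; intros; apply PS_eval_scal.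
Qed.

(** * Growth of the coefficients *)

Lemma nat_least (P : nat -> Prop) (n : nat) :
  P n -> exists m, P m /\ forall k, (k < m)%nat -> ~ P k.
Proof.
  induction n as [n IH] using (well_founded_induction lt_wf); intros Hn.
  destruct (classic (exists k, (k < n)%nat /\ P k)) as [[k [Hk Pk]]|H].
  - now apply (IH k).
  - exists n; split; [exact Hn|]; intros k Hk Pk; apply H; eauto.
Qed.

Lemma positive_lower_bound (f : nat -> R) (n : nat) :
  (forall i, (i < n)%nat -> 0 < f i) ->
  exists c, 0 < c /\ forall i, (i < n)%nat -> c <= f i.
Proof.
  induction n as [|n IH]; intros H.
  - exists 1; split; [lra|]; intros; lia.
  - destruct IH as [c [Hc Hf]]; [intros; apply H; lia|].
    exists (Rmin c (f n)); split; [apply Rmin_pos; auto|].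
    intros i Hi; destruct (Nat.eq_dec i n) as [->|Hn]; [apply Rmin_r|].
    apply Rle_trans with c; [apply Rmin_l|apply Hf; lia].
Qed.

(** * Numerical semigroups *)

Lemma semigroup_mult (A : nat -> Prop) (a q : nat) :
  A 0%nat -> (forall m n, A m -> A n -> A (m + n)%nat) -> A a -> A (q * a)%nat.
Proof.
  intros H0 HD Ha; induction q as [|q IH]; simpl; auto.
Qed.

(* The least positive difference [e] of two elements of [A] divides every
   element of [A], as the remainder modulo [e] is again a difference. *)
Lemma semigroup_gcd_difference (A : nat -> Prop) (d : nat) :
  A 0%nat -> (forall m n, A m -> A n -> A (m + n)%nat) -> d <> 0%nat ->
  (forall k, A k -> Nat.divide d k) ->
  (forall e, (forall k, A k -> Nat.divide e k) -> Nat.divide e d) ->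
  exists a, A a /\ A (a + d)%nat.
Proof.
  intros H0 HD Hd Hdiv Hgcd.
  set (P e := e <> 0%nat /\ exists a, A a /\ A (a + e)%nat).
  assert (Hex : exists k, P k).
  { apply NNPP; intros Hn; apply Hd.
    apply Nat.divide_0_l, Hgcd; intros k Hk.
    destruct (Nat.eq_dec k 0) as [->|Hk0]; [apply Nat.divide_0_r|].
    exfalso; apply Hn; exists k; split; [exact Hk0|]; exists 0%nat; auto. }
  destruct Hex as [k0 Hk0]; destruct (nat_least P k0 Hk0) as [e [[He [a [Ha Hae]]] Hmin]].
  assert (Hed : Nat.divide e d).
  { apply Hgcd; intros k Hk.
    apply Nat.Lcm0.mod_divide; [].
    destruct (Nat.eq_dec (k mod e) 0) as [|Hr]; [assumption|].
    exfalso; apply (Hmin (k mod e)); [now apply Nat.mod_upper_bound|].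
    (* Both [(k / e) * (a + e)] and [(k / e) * a + k] lie in [A], and they differ by [k mod e]. *)
    split; [exact Hr|]; exists ((k / e) * (a + e))%nat; split.
    - now apply semigroup_mult.
    - replace (k / e * (a + e) + k mod e)%nat with (k / e * a + k)%nat.
      + apply HD; auto; now apply semigroup_mult.
      + pose proof (Nat.div_mod k e He); nia. }
  assert (Hde : Nat.divide d e).
  { apply (Nat.divide_add_cancel_r d a e); auto. }
  rewrite (Nat.divide_antisym d e Hde Hed) in *; eauto.
Qed.

(** With [a = t * d] and [q = i * t + r], [r < t], one has [d * q = (i - r) * a + r * (a + d)], and
    [q >= t * t] ensures [r <= i]. *)
Lemma semigroup_contains_large_multiples (A : nat -> Prop) (a d : nat) :
  A 0%nat -> (forall m n, A m -> A n -> A (m + n)%nat) ->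
  A a -> A (a + d)%nat -> Nat.divide d a ->
  exists N, forall q, (N <= q)%nat -> A (d * q)%nat.
Proof.
  intros H0 HD Ha Had [t ->].
  destruct (Nat.eq_dec t 0) as [->|Ht].
  - exists 0%nat; intros q _; rewrite Nat.mul_comm; now apply semigroup_mult.
  - exists (t * t)%nat; intros q Hq.
    pose proof (Nat.div_mod q t Ht) as E; pose proof (Nat.mod_upper_bound q t Ht) as L.
    set (i := (q / t)%nat) in *; set (r := (q mod t)%nat) in *.
    assert (r <= i)%nat by nia.
    replace (d * q)%nat with ((i - r) * (t * d) + r * (t * d + d))%nat.
    + apply HD; now apply semigroup_mult.
    + rewrite E; replace i with ((i - r) + r)%nat at 2 by lia; ring.
Qed.

Lemma sum_f_R0_nonzero (f : nat -> R) (n : nat) :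
  sum_f_R0 f n <> 0 -> exists i, (i <= n)%nat /\ f i <> 0.
Proof.
  intros H; apply NNPP; intros Hn; apply H, sum_eq_R0; intros i Hi.
  apply NNPP; intros Hf; apply Hn; eauto.
Qed.

Lemma PS_pow_support (a : nat -> R) (d k n : nat) :
  (forall i, (i <= n)%nat -> a i <> 0 -> exists q, i = (1 + d * q)%nat) ->
  PS_pow a k n <> 0 -> exists q, n = (k + d * q)%nat.
Proof.
  revert n; induction k as [|k IH]; intros n H Hn.
  - unfold PS_pow in Hn; simpl in Hn; destruct (Nat.eqb_spec n 0) as [->|]; [|lra].
    exists 0%nat; lia.
  - rewrite PS_pow_S in Hn; destruct (sum_f_R0_nonzero _ _ Hn) as [i [Hi Hi0]].
    destruct (H i Hi) as [q Hq]; [intros E; apply Hi0; rewrite E; ring|].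
    destruct (IH (n - i)%nat) as [q' Hq'];
      [intros; apply H; auto; lia|intros E; apply Hi0; rewrite E; ring|].
    exists (q + q')%nat; lia.
Qed.

Lemma PS_pow_diag (a : nat -> R) (k : nat) :
  (forall i, 0 <= a i) -> a 1%nat ^ k <= PS_pow a k k.
Proof.
  intros Ha; induction k as [|k IH]; [unfold PS_pow; simpl; lra|].
  rewrite PS_pow_S; simpl.
  apply Rle_trans with (a 1%nat * PS_pow a k (S k - 1)).
  - replace (S k - 1)%nat with k by lia; now apply Rmult_le_compat_l.
  - apply (sum_f_R0_term (fun i => a i * PS_pow a k (S k - i))); [|lia].
    intros; apply Rmult_le_pos; auto using PS_pow_ge0.
Qed.

Lemma sum_f_R0_shift_le (f : nat -> R) (m n : nat) :
  (forall i, 0 <= f i) ->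
  sum_f_R0 (fun i => f (i + n)%nat) m <= sum_f_R0 f (m + n).
Proof.
  intros Hf; induction m as [|m IH]; simpl.
  - apply sum_f_R0_term; auto.
  - lra.
Qed.

Lemma continuous_PS_eval (N : nat) (a : nat -> R) (x : R) :
  continuous (PS_eval N a) x.
Proof.
  unfold PS_eval; induction N as [|N IH]; simpl.
  - apply continuous_const.
  - apply (continuous_plus (fun r => sum_f_R0 (fun n => a n * r ^ n) N)); [exact IH|].
    apply (ex_derive_continuous (fun r => a (S N) * r ^ S N)); auto_derive; exact I.
Qed.

(** A crude substitute for taking roots: if [x > 1], then [x <= x ^ S k]. *)
Lemma pow_le_1_plus (x C : R) (k : nat) : 0 <= x -> 0 <= C -> x ^ S k <= C -> x <= 1 + C.
Proof.
  intros Hx HC H; destruct (Rle_dec x 1); [lra|].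
  pose proof (pow_R1_Rle x k ltac:(lra)); simpl in H; nra.
Qed.

Lemma is_lim_seq_PS_eval (a : nat -> R) (r : R) :
  ex_pseries a r -> is_lim_seq (fun N => PS_eval N a r) (PSeries a r).
Proof.
  intros H; apply ex_pseries_R in H.
  apply is_lim_seq_ext with (sum_n (fun n => a n * r ^ n)).
  - intros N; apply sum_n_Reals.
  - apply (Series_correct _ H).
Qed.

Lemma PS_eval_le_PSeries (a : nat -> R) (r : R) (N : nat) :
  0 <= r -> (forall i, 0 <= a i) -> ex_pseries a r -> PS_eval N a r <= PSeries a r.
Proof.
  intros Hr Ha H.
  apply (is_lim_seq_incr_compare _ _ (is_lim_seq_PS_eval a r H)).
  intros n; now apply PS_eval_mono; auto.
Qed.

(** * Support and supermultiplicativity of the tree series *)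

Section TreeSeries.

Context (Z omega : nat -> R) (d : nat).
Context (Z_ge0 : forall n, 0 <= Z n) (omega_ge0 : forall k, 0 <= omega k)
  (Z_0 : Z 0%nat = 0) (Z_eq : forall n, Z n = PS_incr_1 (PS_comp omega Z) n)
  (omega_0 : 0 < omega 0%nat) (omega_k : exists k, (2 <= k)%nat /\ 0 < omega k)
  (d_gcd : is_support_gcd omega d).

Lemma tree_S (n : nat) : Z (S n) = PS_comp omega Z n.
Proof. now rewrite Z_eq. Qed.

Lemma tree_1 : Z 1%nat = omega 0%nat.
Proof. rewrite tree_S; unfold PS_comp, PS_pow; simpl; ring. Qed.

Lemma gcd_pos : d <> 0%nat.
Proof.
  destruct omega_k as [k [Hk Hw]]; intros ->.
  apply d_gcd in Hw; apply Nat.divide_0_l in Hw; lia.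
Qed.

(** A root with [k] branches, each of size 1 modulo [d], has branches of total size [k] modulo [d],
    that is 0 when [omega k > 0]. *)
Lemma tree_support (n : nat) : Z n <> 0 -> exists q, n = (1 + d * q)%nat.
Proof.
  induction n as [n IH] using (well_founded_induction lt_wf); intros Hn.
  destruct n as [|n]; [contradiction|].
  rewrite tree_S in Hn; destruct (sum_f_R0_nonzero _ _ Hn) as [k [Hk Hk0]].
  assert (Hw : 0 < omega k).
  { destruct (omega_ge0 k) as [H|H]; [exact H|].
    exfalso; apply Hk0; rewrite <- H; ring. }
  apply d_gcd in Hw; destruct Hw as [p ->].
  destruct (PS_pow_support Z d (p * d) n) as [q Hq].
  - intros i Hi; apply IH; lia.
  - intros E; apply Hk0; rewrite E; ring.
  - exists (p + q)%nat; lia.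
Qed.

Lemma tree_ge_term (k n : nat) : omega k * PS_pow Z k n <= Z (S n).
Proof.
  destruct (le_lt_dec k n) as [Hk|Hk].
  - rewrite tree_S; unfold PS_comp.
    apply (sum_f_R0_term (fun k => omega k * PS_pow Z k n)); auto.
    intros; apply Rmult_le_pos; auto using PS_pow_ge0.
  - rewrite PS_pow_low by auto; rewrite Rmult_0_r; auto.
Qed.

(* Substituting a tree for the leftmost leaf of another tree. *)
Lemma tree_graft (m n : nat) : Z (S m) * Z (S n) <= omega 0%nat * Z (S (m + n)).
Proof.
  revert n; induction m as [m IH] using (well_founded_induction lt_wf); intros n.
  destruct m as [|m]; [rewrite tree_1; simpl; lra|].
  (* The grafting takes place in the first of the [S k] branches at the root, to which the induction
     hypothesis applies. *)
  assert (Hpow : forall k,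
    PS_pow Z (S k) (S m) * Z (S n) <= omega 0%nat * PS_pow Z (S k) (S m + n)).
  { intros k; rewrite !PS_pow_S; unfold PS_mult.
    eapply Rle_trans with (omega 0%nat *
      sum_f_R0 (fun i => Z (i + n)%nat * PS_pow Z k (S m + n - (i + n))) (S m)).
    - rewrite (Rmult_comm _ (Z (S n))), !scal_sum; apply sum_Rle; intros [|i] Hi.
      + rewrite Z_0; ring_simplify.
        apply Rmult_le_pos; [|lra].
        apply Rmult_le_pos; auto using PS_pow_ge0.
      + replace (S m + n - (S i + n))%nat with (S m - S i)%nat by lia.
        specialize (IH i ltac:(lia) n); simpl (S i + n)%nat.
        pose proof (PS_pow_ge0 Z k (S m - S i) Z_ge0); nra.
    - apply Rmult_le_compat_l; [lra|].
      apply (sum_f_R0_shift_le (fun i => Z i * PS_pow Z k (S m + n - i))).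
      intros; apply Rmult_le_pos; auto using PS_pow_ge0. }
  rewrite (tree_S (S m)), (tree_S (S m + n)).
  apply Rle_trans with (omega 0%nat *
    sum_f_R0 (fun k => omega k * PS_pow Z k (S m + n)) (S m)).
  - unfold PS_comp; rewrite (Rmult_comm _ (Z (S n))), !scal_sum.
    apply sum_Rle; intros [|k] _.
    + unfold PS_pow; simpl; lra.
    + specialize (Hpow k); pose proof (omega_ge0 (S k)); nra.
  - apply Rmult_le_compat_l; [lra|].
    apply (sum_f_R0_mono (fun k => omega k * PS_pow Z k (S m + n))); [|lia].
    intros; apply Rmult_le_pos; auto using PS_pow_ge0.
Qed.

Lemma tree_pos_add (m n : nat) : 0 < Z (S m) -> 0 < Z (S n) -> 0 < Z (S (m + n)).
Proof. intros Hm Hn; pose proof (tree_graft m n); nra. Qed.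

(** A root with [k] leaves as children has size [S k] and weight [omega k * omega 0 ^ k]. *)
Lemma tree_pos_omega (k : nat) : 0 < omega k -> 0 < Z (S k).
Proof.
  intros Hk; eapply Rlt_le_trans; [|apply (tree_ge_term k k)].
  apply Rmult_lt_0_compat; [exact Hk|].
  eapply Rlt_le_trans; [|now apply PS_pow_diag].
  rewrite tree_1; now apply pow_lt.
Qed.

Lemma tree_pos_divide (k : nat) : 0 < Z (S k) -> Nat.divide d k.
Proof.
  intros Hk; destruct (tree_support (S k)) as [q Hq]; [lra|].
  exists q; lia.
Qed.

(** By grafting, the [k] with [Z (S k) > 0] form a semigroup. It consists of multiples of [d] and
    contains the support of [omega], so its greatest common divisor is [d]. *)
Lemma tree_pos_pair : exists a, 0 < Z (S a) /\ 0 < Z (S (a + d)).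
Proof.
  apply (semigroup_gcd_difference (fun k => 0 < Z (S k))).
  - now rewrite tree_1.
  - apply tree_pos_add.
  - apply gcd_pos.
  - apply tree_pos_divide.
  - intros e He; apply d_gcd; intros k Hk; now apply He, tree_pos_omega.
Qed.

Lemma tree_pos_large : exists N, forall q, (N <= q)%nat -> 0 < Z (S (d * q)).
Proof.
  destruct tree_pos_pair as [a [Ha Had]].
  apply (semigroup_contains_large_multiples (fun k => 0 < Z (S k)) a); auto.
  - now rewrite tree_1.
  - apply tree_pos_add.
  - now apply tree_pos_divide.
Qed.

Lemma PS_eval_tree_S (N : nat) (r : R) :
  PS_eval (S N) Z r = r * PS_eval N (PS_comp omega Z) r.
Proof.
  rewrite PS_eval_S, Z_0, Rplus_0_l; f_equal; apply PS_eval_ext; intros; apply tree_S.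
Qed.

(** A finite form of [r phi(Z(r)) <= Z(r)]: truncating at [K * N + K] keeps all indices up to [K]
    and all degrees of the [k]-th power of the truncation at [N], for [k <= K]. *)
Lemma PS_eval_tree_ge (K N : nat) (r : R) :
  0 <= r ->
  r * sum_f_R0 (fun k => omega k * PS_eval N Z r ^ k) K <= PS_eval (S (K * N + K)) Z r.
Proof.
  intros Hr; rewrite PS_eval_tree_S; apply Rmult_le_compat_l; [exact Hr|].
  rewrite PS_eval_comp by exact Z_0.
  eapply Rle_trans;
    [|apply (sum_f_R0_mono
        (fun k => omega k * PS_eval (K * N + K) (PS_pow Z k) r) K (K * N + K)); [|lia]].
  - apply sum_Rle; intros k Hk; apply Rmult_le_compat_l; [auto|].
    eapply Rle_trans; [now apply PS_eval_pow_ge|].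
    apply PS_eval_mono; auto using PS_pow_ge0; nia.
  - intros k; apply Rmult_le_pos; [auto|].
    apply PS_eval_ge0; auto using PS_pow_ge0.
Qed.

(** Here [N] tends to infinity with [K] fixed, so that only the continuity of a polynomial in [t]
    enters, and not the convergence of [phi] at [t]. *)
Lemma tree_value_ge (r t : R) (K : nat) :
  0 <= r -> is_lim_seq (fun N => PS_eval N Z r) t ->
  r * sum_f_R0 (fun k => omega k * t ^ k) K <= t.
Proof.
  intros Hr Ht.
  assert (Hle : forall N, PS_eval N Z r <= t).
  { apply (is_lim_seq_incr_compare _ _ Ht); intros n; now apply PS_eval_mono; auto. }
  assert (Hcont : continuous (fun s => r * PS_eval K omega s) t).
  { apply (continuous_mult (fun _ => r)); [apply continuous_const|].
    apply continuous_PS_eval. }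
  apply (is_lim_seq_le (fun N => r * PS_eval K omega (PS_eval N Z r)) (fun _ => t)
           (Finite (r * PS_eval K omega t)) (Finite t)).
  - intros N; eapply Rle_trans; [now apply PS_eval_tree_ge|apply Hle].
  - apply (filterlim_comp _ _ _ _ _ _ _ _ Ht Hcont).
  - apply is_lim_seq_const.
Qed.

(** Both bounds keep a single term of [r phi(t) <= t], where [t = Z(r)]: the constant one, and the
    one of degree [k] divided by [t]. As [k >= 2], the latter bounds [t] from above. *)
Lemma tree_value_bound (k : nat) (r : R) :
  (2 <= k)%nat -> 0 < omega k -> 0 < r -> ex_pseries Z r ->
  r * omega 0%nat <= PSeries Z r /\ r * omega k * PSeries Z r ^ (k - 1) <= 1.
Proof.
  intros Hk Hw Hr Hex.
  pose proof (is_lim_seq_PS_eval Z r Hex) as Hlim.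
  assert (Hpos : r * omega 0%nat <= PSeries Z r).
  { pose proof (tree_value_ge r _ 0 ltac:(lra) Hlim) as H; simpl in H; lra. }
  split; [exact Hpos|].
  assert (0 < r * omega 0%nat) by now apply Rmult_lt_0_compat.
  set (t := PSeries Z r) in *.
  apply Rmult_le_reg_r with t; [lra|].
  assert (Ek : t ^ k = t ^ (k - 1) * t)
    by (replace k with (S (k - 1)) at 1 by lia; simpl; ring).
  replace (r * omega k * t ^ (k - 1) * t) with (r * (omega k * t ^ k)) by (rewrite Ek; ring).
  rewrite Rmult_1_l.
  eapply Rle_trans; [|apply (tree_value_ge r t k); [lra|exact Hlim]].
  apply Rmult_le_compat_l; [lra|].
  apply (sum_f_R0_term (fun k => omega k * t ^ k)); [|lia].
  intros; apply Rmult_le_pos; [auto|apply pow_le; lra].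
Qed.

(** * The radius of convergence and the growth rate *)

Lemma ex_pseries_inside (r : R) :
  0 < r -> Rbar_lt r (CV_radius Z) -> ex_pseries Z r.
Proof.
  intros Hr H; apply CV_radius_inside; now rewrite Rabs_right by lra.
Qed.

Context (radius_Z : Rbar_lt 0 (CV_radius Z)).

(** If the radius were infinite, the two bounds on [t = Z(r)], namely [r * omega 0 <= t] and
    [r * omega k * t ^ (k - 1) <= 1], would give [r ^ k <= C] for every [r > 0]. By [pow_le_1_plus],
    this fails for [r = 2 + C]. *)
Lemma tree_radius_finite : exists rho, CV_radius Z = Finite rho /\ 0 < rho.
Proof.
  destruct (CV_radius Z) as [rho| |] eqn:E; [exists rho; split; auto| |contradiction].
  exfalso; destruct omega_k as [k [Hk Hw]].
  set (C := / (omega k * omega 0%nat ^ (k - 1))).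
  assert (HC : 0 < C).
  { apply Rinv_0_lt_compat, Rmult_lt_0_compat; auto using pow_lt. }
  set (r := 2 + C).
  assert (Hr : 0 < r) by (unfold r; lra).
  destruct (tree_value_bound k r) as [H1 H2]; auto.
  { apply ex_pseries_inside; [exact Hr|now rewrite E]. }
  assert (Hpow : (r * omega 0%nat) ^ (k - 1) <= PSeries Z r ^ (k - 1)).
  { apply pow_incr; split; [apply Rmult_le_pos; lra|exact H1]. }
  assert (r ^ S (k - 1) <= C).
  { apply Rmult_le_reg_r with (omega k * omega 0%nat ^ (k - 1)).
    - apply Rmult_lt_0_compat; auto using pow_lt.
    - unfold C; rewrite Rinv_l
        by (apply Rgt_not_eq, Rmult_lt_0_compat; auto using pow_lt).
      eapply Rle_trans; [|exact H2].
      rewrite Rpow_mult_distr in Hpow; simpl.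
      replace (r * r ^ (k - 1) * (omega k * omega 0%nat ^ (k - 1)))
        with (r * omega k * (r ^ (k - 1) * omega 0%nat ^ (k - 1))) by ring.
      apply Rmult_le_compat_l; [apply Rmult_le_pos; lra|exact Hpow]. }
  pose proof (pow_le_1_plus r C (k - 1) ltac:(lra) ltac:(lra) H); unfold r in *; lra.
Qed.

(** The upper bound of [tree_value_bound] is uniform for [r] in [[rho / 2, rho)]. It passes to the
    partial sums at [rho] by continuity, and these are increasing. *)
Lemma ex_pseries_at_radius (rho : R) :
  CV_radius Z = Finite rho -> 0 < rho -> ex_pseries Z rho.
Proof.
  intros E Hrho; destruct omega_k as [k [Hk Hw]].
  set (C := / (rho / 2 * omega k)).
  assert (HC : 0 < C) by (apply Rinv_0_lt_compat, Rmult_lt_0_compat; lra).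
  assert (Hin : forall r N, rho / 2 <= r < rho -> PS_eval N Z r <= 1 + C).
  { intros r N [Hr1 Hr2].
    assert (Hex : ex_pseries Z r) by (apply ex_pseries_inside; [lra|now rewrite E]).
    apply Rle_trans with (PSeries Z r); [apply PS_eval_le_PSeries; auto; lra|].
    destruct (tree_value_bound k r) as [H1 H2]; auto; [lra|].
    assert (0 < r * omega 0%nat) by (apply Rmult_lt_0_compat; lra).
    apply pow_le_1_plus with (k - 2)%nat; [lra|lra|].
    replace (S (k - 2)) with (k - 1)%nat by lia.
    assert (0 <= PSeries Z r ^ (k - 1)) by (apply pow_le; lra).
    apply Rmult_le_reg_l with (rho / 2 * omega k); [apply Rmult_lt_0_compat; lra|].
    unfold C; rewrite Rinv_r by (apply Rgt_not_eq, Rmult_lt_0_compat; lra).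
    eapply Rle_trans; [|exact H2].
    apply Rmult_le_compat_r; [assumption|].
    apply Rmult_le_compat_r; lra. }
  assert (Hat : forall N, PS_eval N Z rho <= 1 + C).
  { intros N; apply Rnot_lt_le; intros Hlt.
    pose proof (continuous_PS_eval N Z rho) as Hc.
    destruct (proj1 (filterlim_locally _ _) Hc
      (mkposreal (PS_eval N Z rho - (1 + C)) ltac:(lra))) as [eps Heps].
    destruct eps as [eps He]; simpl in Heps.
    (* This puts [rho - h] both in [[rho / 2, rho)] and within [eps] of [rho]. *)
    set (h := Rmin (eps / 2) (rho / 2)).
    assert (0 < h <= rho / 2 /\ h < eps) as [[Hh1 Hh2] Hh3].
    { unfold h; pose proof (Rmin_l (eps / 2) (rho / 2)); pose proof (Rmin_r (eps / 2) (rho / 2)).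
      pose proof (Rmin_pos (eps / 2) (rho / 2)); lra. }
    specialize (Heps (rho - h)); specialize (Hin (rho - h) N ltac:(lra)).
    assert (Hb : ball (PS_eval N Z rho) (PS_eval N Z rho - (1 + C)) (PS_eval N Z (rho - h))).
    { apply Heps; change (Rabs (rho - h - rho) < eps).
      replace (rho - h - rho) with (- h) by ring; rewrite Rabs_Ropp, Rabs_right; lra. }
    change (Rabs (PS_eval N Z (rho - h) - PS_eval N Z rho) < PS_eval N Z rho - (1 + C)) in Hb.
    apply Rabs_def2 in Hb; lra. }
  apply ex_pseries_R.
  destruct (ex_finite_lim_seq_incr (fun N => PS_eval N Z rho) (1 + C)) as [l Hl].
  - intros n; apply PS_eval_mono; auto; lra.
  - exact Hat.
  - exists l; apply (is_lim_seq_ext (fun N => PS_eval N Z rho) _ (Finite l)); [|exact Hl].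
    intros N; symmetry; apply sum_n_Reals.
Qed.

(** Otherwise [Z n / q ^ n] would be bounded and the radius would be at least [/ q > rho]. *)
Lemma tree_growth_witness (rho q : R) :
  CV_radius Z = Finite rho -> 0 < rho -> 0 < q < / rho ->
  exists m, (1 <= m)%nat /\ omega 0%nat * q ^ m <= Z (S m).
Proof.
  intros E Hrho [Hq Hqr]; apply NNPP; intros Hn.
  assert (Hlt : forall m, Z (S m) <= omega 0%nat * q ^ m).
  { intros [|m]; [rewrite tree_1; simpl; lra|].
    apply Rnot_lt_le; intros H; apply Hn; exists (S m); split; [lia|lra]. }
  destruct (CV_radius_bounded Z) as [Hub _]; specialize (Hub (/ q)).
  rewrite E in Hub; simpl in Hub.
  assert (/ q <= rho).
  { apply Hub; exists (omega 0%nat * / q); intros [|n].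
    - rewrite Z_0, Rmult_0_l, Rabs_R0.
      apply Rmult_le_pos; [lra|]; left; now apply Rinv_0_lt_compat.
    - assert (Hp : 0 < / q ^ n) by (apply Rinv_0_lt_compat, pow_lt; lra).
      assert (Hq' : 0 < / q) by now apply Rinv_0_lt_compat.
      rewrite pow_inv; simpl.
      rewrite Rinv_mult, Rabs_right
        by (apply Rle_ge, Rmult_le_pos; [auto|left; now apply Rmult_lt_0_compat]).
      apply Rle_trans with (omega 0%nat * q ^ n * (/ q * / q ^ n)).
      + apply Rmult_le_compat_r; [left; now apply Rmult_lt_0_compat|apply Hlt].
      + right; field; repeat split; try apply pow_nonzero; lra. }
  apply Rinv_lt_contravar in Hqr; [|apply Rmult_lt_0_compat; auto using Rinv_0_lt_compat].
  rewrite Rinv_inv in Hqr; lra.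
Qed.

(* Fekete's argument for the supermultiplicative sequence
   [Z (S n) / omega 0]. *)
Lemma tree_growth (rho q : R) :
  CV_radius Z = Finite rho -> 0 < rho -> 0 < q < / rho ->
  exists c N, 0 < c /\ forall n, (N <= n)%nat -> c * q ^ (d * n) <= Z (S (d * n)).
Proof.
  intros E Hrho Hq.
  destruct (tree_growth_witness rho q E Hrho Hq) as [m [Hm1 Hm]].
  assert (Hpos : 0 < Z (S m)).
  { eapply Rlt_le_trans; [|exact Hm]; apply Rmult_lt_0_compat; [lra|apply pow_lt; lra]. }
  destruct (tree_pos_divide m Hpos) as [p ->].
  assert (Hp : p <> 0%nat) by (intros ->; simpl in Hm1; lia).
  (* Each grafting of a tree of size [S (p * d)] gains a factor [q ^ (p * d)]: the [omega 0] in the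
     choice of the size cancels the one in [tree_graft]. *)
  assert (Hrep : forall j x, q ^ (p * d * j) * Z (S x) <= Z (S (p * d * j + x))).
  { intros j x; induction j as [|j IH]; [rewrite Nat.mul_0_r; simpl; lra|].
    replace (p * d * S j + x)%nat with (p * d + (p * d * j + x))%nat by lia.
    replace (p * d * S j)%nat with (p * d + p * d * j)%nat by lia.
    rewrite pow_add, Rmult_assoc.
    apply Rmult_le_reg_l with (omega 0%nat); [lra|].
    eapply Rle_trans; [|apply tree_graft].
    apply Rle_trans with (omega 0%nat * q ^ (p * d) * Z (S (p * d * j + x))).
    - rewrite <- Rmult_assoc; apply Rmult_le_compat_l; [|exact IH].
      apply Rmult_le_pos; [|apply pow_le]; lra.
    - now apply Rmult_le_compat_r. }
  destruct tree_pos_large as [N HN].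
  (* Writing [n - N = p * j + r] reduces the bound to the [p] starting sizes with [r < p]; [c] is a
     lower bound of their ratios. *)
  destruct (positive_lower_bound (fun i => Z (S (d * (N + i))) / q ^ (d * (N + i))) p)
    as [c [Hc Hci]].
  { intros i _; apply Rdiv_lt_0_compat; [apply HN; lia|apply pow_lt; lra]. }
  exists c, N; split; [exact Hc|]; intros n Hn.
  pose proof (Nat.div_mod (n - N) p Hp) as Ed.
  pose proof (Nat.mod_upper_bound (n - N) p Hp) as Hr.
  set (j := ((n - N) / p)%nat) in *; set (r := ((n - N) mod p)%nat) in *.
  replace (d * n)%nat with (p * d * j + d * (N + r))%nat
    by (replace n with (N + (p * j + r))%nat by lia; ring).
  eapply Rle_trans; [|apply Hrep].
  rewrite pow_add, <- Rmult_assoc, (Rmult_comm c), Rmult_assoc.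
  apply Rmult_le_compat_l; [apply pow_le; lra|].
  specialize (Hci r Hr); simpl in Hci.
  apply Rmult_le_compat_r with (r := q ^ (d * (N + r))) in Hci; [|apply pow_le; lra].
  unfold Rdiv in Hci; rewrite Rmult_assoc, Rinv_l in Hci; [lra|].
  apply pow_nonzero; lra.
Qed.

End TreeSeries.

(** * Marked fringe subtrees *)

(** [f] dominates [a * exp (t * (e / a))], with [e = 0] required when [a = 0]
    (then [e / a = 0] and the bound reads [0 <= f]).  For [a = a(0)] and
    [e = a'(0)] this bounds [a(t)] from below by log-convexity. *)
Definition exp_dominates (t f a e : R) : Prop :=
  0 <= a /\ (a = 0 -> e = 0) /\ a * exp (t * (e / a)) <= f.

Lemma exp_dominates_0 (t f : R) : 0 <= f -> exp_dominates t f 0 0.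
Proof. intros Hf; repeat split; [lra|]; rewrite Rmult_0_l; exact Hf. Qed.

Lemma exp_dominates_const (t a : R) : 0 <= a -> exp_dominates t a a 0.
Proof.
  intros Ha; repeat split; [exact Ha|].
  unfold Rdiv; rewrite Rmult_0_l, Rmult_0_r, exp_0; lra.
Qed.

Lemma exp_dominates_ge0 (t f a e : R) : exp_dominates t f a e -> 0 <= f.
Proof.
  intros [Ha [_ H]]; eapply Rle_trans; [|exact H].
  apply Rmult_le_pos; [exact Ha|left; apply exp_pos].
Qed.

(** Jensen's inequality for [exp]: [(e + e') / (a + a')] is the mean of [e / a] and [e' / a'] with
    weights [a] and [a']. *)
Lemma exp_dominates_plus (t f a e f' a' e' : R) :
  exp_dominates t f a e -> exp_dominates t f' a' e' ->
  exp_dominates t (f + f') (a + a') (e + e').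
Proof.
  intros H H'; pose proof (exp_dominates_ge0 _ _ _ _ H) as Hf.
  pose proof (exp_dominates_ge0 _ _ _ _ H') as Hf'.
  destruct H as [Ha [He H]], H' as [Ha' [He' H']].
  destruct Ha as [Ha|<-].
  2:{ rewrite (He eq_refl), !Rplus_0_l; repeat split; auto; lra. }
  destruct Ha' as [Ha'|<-].
  2:{ rewrite (He' eq_refl), !Rplus_0_r; repeat split; auto; lra. }
  repeat split; [lra|lra|].
  set (v := t * ((e + e') / (a + a'))).
  set (v1 := t * (e / a)) in *; set (v2 := t * (e' / a')) in *.
  assert (Hv : a * v1 + a' * v2 = (a + a') * v)
    by (unfold v, v1, v2; field; repeat split; lra).
  (* The tangent line of [exp] at [v]. *)
  assert (Htan : forall w, exp v * (1 + (w - v)) <= exp w).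
  { intros w; replace (exp w) with (exp v * exp (w - v))
      by (rewrite <- exp_plus; f_equal; ring).
    apply Rmult_le_compat_l; [left; apply exp_pos|apply exp_ineq1_le]. }
  pose proof (Rmult_le_compat_l a _ _ ltac:(lra) (Htan v1)).
  pose proof (Rmult_le_compat_l a' _ _ ltac:(lra) (Htan v2)).
  replace ((a + a') * exp v)
    with (a * (exp v * (1 + (v1 - v))) + a' * (exp v * (1 + (v2 - v)))); [lra|].
  transitivity (exp v * (a + a' + (a * v1 + a' * v2 - (a + a') * v))); [ring|].
  rewrite Hv; ring.
Qed.

(** Logarithmic derivatives add up under products, so the exponentials multiply. *)
Lemma exp_dominates_mult (t f a e f' a' e' : R) :
  exp_dominates t f a e -> exp_dominates t f' a' e' ->
  exp_dominates t (f * f') (a * a') (e * a' + a * e').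
Proof.
  intros H H'; pose proof (exp_dominates_ge0 _ _ _ _ H) as Hf.
  pose proof (exp_dominates_ge0 _ _ _ _ H') as Hf'.
  destruct H as [Ha [He H]], H' as [Ha' [He' H']].
  destruct Ha as [Ha|<-].
  2:{ rewrite (He eq_refl), !Rmult_0_l, Rplus_0_l.
      apply exp_dominates_0, Rmult_le_pos; auto. }
  destruct Ha' as [Ha'|<-].
  2:{ rewrite (He' eq_refl), !Rmult_0_r, Rplus_0_l.
      apply exp_dominates_0, Rmult_le_pos; auto. }
  assert (0 < a * a') by now apply Rmult_lt_0_compat.
  repeat split; [lra|lra|].
  replace (t * ((e * a' + a * e') / (a * a'))) with (t * (e / a) + t * (e' / a'))
    by (field; lra).
  rewrite exp_plus.
  replace (a * a' * (exp (t * (e / a)) * exp (t * (e' / a'))))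
    with ((a * exp (t * (e / a))) * (a' * exp (t * (e' / a')))) by ring.
  apply Rmult_le_compat; auto; apply Rmult_le_pos; try lra; left; apply exp_pos.
Qed.

Lemma exp_dominates_sum (t : R) (f a e : nat -> R) (n : nat) :
  (forall i, (i <= n)%nat -> exp_dominates t (f i) (a i) (e i)) ->
  exp_dominates t (sum_f_R0 f n) (sum_f_R0 a n) (sum_f_R0 e n).
Proof.
  induction n as [|n IH]; intros H; simpl; [now apply H|].
  apply exp_dominates_plus; [apply IH; intros; apply H|apply H]; lia.
Qed.

Lemma exp_dominates_PS_mult (t : R) (f a e f' a' e' : nat -> R) (n : nat) :
  (forall i, (i <= n)%nat -> exp_dominates t (f i) (a i) (e i)) ->
  (forall i, (i <= n)%nat -> exp_dominates t (f' i) (a' i) (e' i)) ->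
  exp_dominates t ((f ** f') n) ((a ** a') n) ((e ** a') n + (a ** e') n).
Proof.
  intros H H'; unfold PS_mult; rewrite <- plus_sum; apply exp_dominates_sum.
  intros i Hi; apply exp_dominates_mult; [apply H|apply H']; lia.
Qed.

Lemma exp_dominates_PS_pow (t : R) (f a e : nat -> R) (k n : nat) :
  (forall i, (i <= n)%nat -> exp_dominates t (f i) (a i) (e i)) ->
  exp_dominates t (PS_pow f k n) (PS_pow a k n) (PS_dpow a e k n).
Proof.
  revert n; induction k as [|k IH]; intros n H.
  - apply exp_dominates_const; unfold PS_pow; simpl; destruct (Nat.eqb n 0); lra.
  - rewrite !PS_pow_S; simpl; apply exp_dominates_PS_mult; [exact H|].
    intros i Hi; apply IH; intros; apply H; lia.
Qed.

Lemma exp_dominates_PS_comp (t : R) (w f a e : nat -> R) (n : nat) :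
  (forall k, 0 <= w k) -> a 0%nat = 0 -> e 0%nat = 0 ->
  (forall i, (i <= n)%nat -> exp_dominates t (f i) (a i) (e i)) ->
  exp_dominates t (PS_comp w f n) (PS_comp w a n)
    ((PS_comp (PS_derive w) a ** e) n).
Proof.
  intros Hw Ha He H; rewrite <- sum_PS_dpow by assumption.
  apply exp_dominates_sum; intros k _.
  replace (w k * PS_dpow a e k n) with (0 * PS_pow a k n + w k * PS_dpow a e k n) by ring.
  apply exp_dominates_mult; [now apply exp_dominates_const|].
  now apply exp_dominates_PS_pow.
Qed.

Lemma PS_eval_PS_mono (N s : nat) (c r : R) :
  (s <= N)%nat -> PS_eval N (PS_mono s c) r = c * r ^ s.
Proof.
  intros HN; unfold PS_eval.
  rewrite (sum_f_R0_extend _ s N); [|exact HN|].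
  - destruct s as [|s]; [unfold PS_mono; simpl; ring|].
    rewrite tech5, sum_eq_R0.
    + unfold PS_mono; rewrite Nat.eqb_refl; ring.
    + intros i Hi; unfold PS_mono; destruct (Nat.eqb_spec i (S s)); [lia|ring].
  - intros i Hi; unfold PS_mono; destruct (Nat.eqb_spec i s); [lia|ring].
Qed.

(** Generating series of the trees with a weight [x] for each fringe subtree of
    size [s]; the [m]-th iterate has the correct coefficients below [s + m]. *)
Fixpoint marked_series (Z omega : nat -> R) (s : nat) (x : R) (m : nat) : nat -> R :=
  match m with
  | O => fun n => if Nat.ltb n s then Z n else 0
  | S m => fun n =>
      if Nat.eqb n s then x * Z s
      else PS_incr_1 (PS_comp omega (marked_series Z omega s x m)) n
  end.

(** The series [1 / (1 - z phi'(Z))]: [Z s * spine_series (n - s)] is the weight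
    of the trees of size [n] with a distinguished fringe subtree of size [s]. *)
Definition spine_series (Z omega : nat -> R) : nat -> R :=
  PS_geom (PS_incr_1 (PS_comp (PS_derive omega) Z)).

Lemma PS_mult_incr_1 (a b : nat -> R) (n : nat) :
  (PS_incr_1 a ** b) (S n) = (a ** b) n.
Proof.
  rewrite PS_mult_S_l; change (0 * b (S n) + (a ** b) n = (a ** b) n); ring.
Qed.

Lemma PS_mult_incr_1_0 (a b : nat -> R) : (PS_incr_1 a ** b) 0%nat = 0.
Proof.
  change (0 * b 0%nat = 0); ring.
Qed.

Section Marking.

Context (Z omega : nat -> R).
Context (Z_ge0 : forall n, 0 <= Z n) (omega_ge0 : forall k, 0 <= omega k)
  (Z_0 : Z 0%nat = 0) (Z_eq : forall n, Z n = PS_incr_1 (PS_comp omega Z) n).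

Local Notation psi := (PS_incr_1 (PS_comp (PS_derive omega) Z)).
Local Notation b := (spine_series Z omega).

Lemma spine_eq (n : nat) : b n = PS_one n + (psi ** b) n.
Proof. now apply PS_geom_eq. Qed.

Lemma spine_0 : b 0%nat = 1.
Proof.
  rewrite spine_eq, PS_mult_incr_1_0; unfold PS_one; simpl; ring.
Qed.

(** The Euler operator turns [Z = z phi(Z)] into [PS_theta Z = Z + psi ** PS_theta Z]. Expanding
    [PS_theta Z ** b] by this equation and by [b = 1 + psi ** b] produces the same term
    [PS_theta Z ** (psi ** b)], which cancels. *)
Lemma PS_theta_tree : PS_theta Z = Z ** b.
Proof.
  assert (E : forall n, PS_theta Z n = Z n + (psi ** PS_theta Z) n).
  { intros [|n].
    - rewrite PS_mult_incr_1_0; unfold PS_theta; rewrite Z_0; simpl; ring.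
    - rewrite PS_mult_incr_1, <- PS_theta_comp by exact Z_0.
      unfold PS_theta; rewrite Z_eq, S_INR; simpl; ring. }
  assert (E1 : PS_theta Z ** b = fun n => PS_theta Z n + (PS_theta Z ** (psi ** b)) n).
  { extensionality n.
    rewrite (PS_mult_eq _ (PS_theta Z) _ (fun i => PS_one i + (psi ** b) i))
      by (auto using spine_eq).
    now rewrite PS_mult_plus_r, PS_mult_comm, PS_mult_one_l. }
  assert (E2 : PS_theta Z ** b = fun n => (Z ** b) n + (PS_theta Z ** (psi ** b)) n).
  { extensionality n.
    rewrite (PS_mult_eq _ (fun i => Z i + (psi ** PS_theta Z) i) _ b) by auto.
    now rewrite PS_mult_plus_l, PS_mult_assoc, (PS_mult_comm (PS_theta Z)). }
  extensionality n; rewrite E1 in E2; apply (f_equal (fun f => f n)) in E2; lra.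
Qed.

Context (s : nat) (s_pos : (1 <= s)%nat) (t : R).

Local Notation E := (PS_mono s (Z s) ** b).
Local Notation G := (marked_series Z omega s (exp t)).

(** The distinguished fringe subtree is the whole tree or lies in a branch at the root. *)
Lemma fringe_eq (n : nat) : E n = PS_mono s (Z s) n + (psi ** E) n.
Proof.
  rewrite (PS_mult_eq _ (PS_mono s (Z s)) b (fun i => PS_one i + (psi ** b) i))
    by (auto using spine_eq).
  rewrite PS_mult_plus_r, PS_mult_assoc, (PS_mult_comm _ psi), <- PS_mult_assoc.
  now rewrite (PS_mult_comm _ PS_one), PS_mult_one_l.
Qed.

Lemma fringe_low (n : nat) : (n < s)%nat -> E n = 0.
Proof.
  intros Hn; rewrite PS_mult_mono.
  destruct (Nat.ltb_spec n s); [reflexivity|lia].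
Qed.

Lemma marked_ge0 (m n : nat) : 0 <= G m n.
Proof.
  revert n; induction m as [|m IH]; intros n; simpl.
  - destruct (Nat.ltb n s); [auto|lra].
  - destruct (Nat.eqb n s).
    + apply Rmult_le_pos; [left; apply exp_pos|auto].
    + destruct n; [apply Rle_refl|apply PS_comp_ge0; auto].
Qed.

Lemma marked_low (m n : nat) : (n < s)%nat -> G m n = Z n.
Proof.
  revert n; induction m as [|m IH]; intros n Hn; simpl.
  - destruct (Nat.ltb_spec n s); [reflexivity|lia].
  - destruct (Nat.eqb_spec n s); [lia|].
    rewrite (Z_eq n); destruct n as [|n]; [reflexivity|].
    apply PS_comp_eq; intros; apply IH; lia.
Qed.

(** Below degree [s] nothing is marked. In degree [s] only the whole tree is, and equality holds.
    Above, the recursion for [G] dominates that for [Z], whose linearization is the recursion for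
    [E]. *)
Lemma marked_lower (m n : nat) : (n < s + m)%nat -> exp_dominates t (G m n) (Z n) (E n).
Proof.
  revert n; induction m as [|m IH]; intros n Hn;
    (destruct (le_lt_dec s n) as [Hs|Hs];
     [|rewrite marked_low, fringe_low by assumption; now apply exp_dominates_const]);
    [lia|].
  simpl; destruct (Nat.eqb_spec n s) as [->|Hns].
  - rewrite PS_mult_mono, Nat.ltb_irrefl, Nat.sub_diag, spine_0.
    repeat split; [auto|lra|].
    destruct (Z_ge0 s) as [H|<-]; [|lra].
    replace (t * (Z s * 1 / Z s)) with t by (field; lra); lra.
  - rewrite fringe_eq; unfold PS_mono at 1.
    destruct (Nat.eqb_spec n s); [lia|]; rewrite Rplus_0_l.
    destruct n as [|n]; [lia|].
    rewrite PS_mult_incr_1, (Z_eq (S n)); simpl.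
    apply exp_dominates_PS_comp; auto.
    + apply fringe_low; lia.
    + intros i Hi; apply IH; lia.
Qed.

(** In degree [s] the branches are smaller than [s] and carry no mark, so the recursion returns
    [Z s] and the mark adds [(exp t - 1) * Z s]. *)
Lemma marked_S_eq (m n : nat) :
  G (S m) n = PS_incr_1 (PS_comp omega (G m)) n + PS_mono s ((exp t - 1) * Z s) n.
Proof.
  simpl; unfold PS_mono; destruct (Nat.eqb_spec n s) as [->|Hn]; [|symmetry; apply Rplus_0_r].
  assert (Hs : forall n, (n <= s)%nat -> PS_incr_1 (PS_comp omega (G m)) n = Z n).
  { intros n Hn; rewrite (Z_eq n); destruct n as [|n]; [reflexivity|].
    apply PS_comp_eq; intros i Hi; apply marked_low; lia. }
  rewrite Hs by lia; ring.
Qed.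

(** The last hypothesis makes [tau] a supersolution at [r] of the fixed-point equation of the marked
    series, so it bounds every iterate once it bounds the initial one. *)
Lemma marked_upper (r tau : R) (m N : nat) :
  0 <= r -> 0 <= tau -> PS_eval (s - 1) Z r <= tau ->
  (forall K, r * PS_eval K omega tau + (exp t - 1) * Z s * r ^ s <= tau) ->
  PS_eval N (G m) r <= tau.
Proof.
  intros Hr Htau H0 H1; revert N; induction m as [|m IH]; intros N.
  - eapply Rle_trans; [apply (PS_eval_mono N (N + (s - 1))); auto using marked_ge0; lia|].
    eapply Rle_trans; [|exact H0]; right; unfold PS_eval.
    rewrite (sum_f_R0_extend _ (s - 1)); [|lia|].
    + apply sum_eq; intros i Hi; now rewrite marked_low by lia.
    + intros i Hi; simpl; destruct (Nat.ltb_spec i s); [lia|ring].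
  (* The longer truncation contains degree [s], so that the mark is counted in full even if
     [exp t - 1] is negative. *)
  - eapply Rle_trans; [apply (PS_eval_mono N (S (N + s))); auto using marked_ge0; lia|].
    rewrite (PS_eval_ext _ _ _ r (fun i _ => marked_S_eq m i)).
    rewrite PS_eval_plus, PS_eval_PS_mono, PS_eval_S by lia.
    apply Rle_trans with
      (r * PS_eval (N + s) (PS_comp omega (G m)) r + (exp t - 1) * Z s * r ^ s).
    { right; apply (f_equal (fun x => x + (exp t - 1) * Z s * r ^ s)), Rplus_0_l. }
    eapply Rle_trans; [|apply (H1 (N + s)%nat)].
    apply Rplus_le_compat_r, Rmult_le_compat_l; [exact Hr|].
    rewrite PS_eval_comp by (rewrite marked_low by lia; exact Z_0).
    apply sum_Rle; intros k _; apply Rmult_le_compat_l; [auto|].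
    eapply Rle_trans; [apply PS_eval_pow_le; auto using marked_ge0|].
    apply pow_incr; split; [apply PS_eval_ge0; auto using marked_ge0|apply IH].
Qed.

(** A Chernoff bound: one coefficient of the [n]-th iterate, already final in degree [n] because
    [s >= 1], is at most the value of the series. *)
Lemma fringe_chernoff (r tau : R) (n : nat) :
  0 <= r -> 0 <= tau -> PS_eval (s - 1) Z r <= tau ->
  (forall K, r * PS_eval K omega tau + (exp t - 1) * Z s * r ^ s <= tau) ->
  Z n * exp (t * (E n / Z n)) * r ^ n <= tau.
Proof.
  intros Hr Htau H0 H1.
  apply Rle_trans with (G n n * r ^ n).
  - apply Rmult_le_compat_r; [now apply pow_le|]; apply marked_lower; lia.
  - apply Rle_trans with (PS_eval n (G n) r); [|now apply marked_upper].
    apply (sum_f_R0_term (fun i => G n i * r ^ i)); [|lia].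
    intros; apply Rmult_le_pos; auto using pow_le, marked_ge0.
Qed.

End Marking.

(** * Convolutions with asymptotically proportional weights *)

Lemma exp_pow_nat (x : R) (n : nat) : exp x ^ n = exp (INR n * x).
Proof.
  induction n as [|n IH]; [simpl; rewrite Rmult_0_l, exp_0; reflexivity|].
  rewrite S_INR; simpl pow; rewrite IH, <- exp_plus; f_equal; ring.
Qed.

Lemma is_derive_decrease (g : R -> R) (l : R) :
  is_derive g 0 l -> l <> 0 ->
  locally 0 (fun h => l * h < 0 -> g h < g 0).
Proof.
  intros Hg Hl; apply is_derive_Reals in Hg.
  destruct (Hg (Rabs l) (Rabs_pos_lt l Hl)) as [eta Heta].
  exists eta; intros h Hh Hlh.
  change (Rabs (h - 0) < eta) in Hh; rewrite Rminus_0_r in Hh.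
  assert (Hh0 : h <> 0) by (intros ->; lra).
  specialize (Heta h Hh0 Hh); rewrite Rplus_0_l in Heta.
  set (D := (g h - g 0) / h) in *.
  assert (HD : g h - g 0 = D * h) by (unfold D; field; exact Hh0).
  apply Rabs_def2 in Heta; unfold Rabs in Heta; destruct (Rcase_abs l); nra.
Qed.

(** Up to the factor [tau], with [r = rho * exp (- (a * t))], this function bounds the left side of
    the supersolution condition. It equals 1 at [t = 0], so the condition holds for small [t] with
    [(p - a) * t < 0]. *)
Lemma is_derive_tilt (p a : R) (s : nat) :
  is_derive (fun t => exp (- (a * t)) + (exp t - 1) * p * exp (- (a * t)) ^ s) 0 (p - a).
Proof.
  auto_derive; [exact I|].
  rewrite Rmult_0_r, Ropp_0, exp_0, !pow1; ring.
Qed.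

Lemma is_lim_seq_affine (alpha beta : R) :
  0 < alpha -> is_lim_seq (fun q => alpha * INR q + beta) p_infty.
Proof.
  intros Ha.
  apply (is_lim_seq_plus _ _ p_infty beta);
    [|apply is_lim_seq_const|reflexivity].
  apply (is_lim_seq_mult _ _ alpha p_infty);
    [apply is_lim_seq_const|apply is_lim_seq_INR|].
  now apply is_Rbar_mult_sym, is_Rbar_mult_p_infty_pos.
Qed.

Lemma is_lim_seq_inv_affine (alpha beta : R) :
  0 < alpha -> is_lim_seq (fun q => / (alpha * INR q + beta)) 0.
Proof.
  intros Ha; apply (is_lim_seq_inv _ p_infty); [|discriminate].
  now apply is_lim_seq_affine.
Qed.

Lemma is_lim_seq_pos (u : nat -> R) (l : R) :
  is_lim_seq u l -> 0 < l -> eventually (fun n => 0 < u n).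
Proof. intros Hu Hl; apply Hu, (open_gt 0 l Hl). Qed.

(** Multiplication by a polynomial: each shift by one degree contributes a factor tending to [L]. *)
Lemma PS_mult_finite_ratio (u e : nat -> R) (L : R) (J : nat) :
  eventually (fun q => 0 < u q) ->
  is_lim_seq (fun q => u q / u (S q)) L ->
  (forall j, (J <= j)%nat -> e j = 0) ->
  exists l : R, is_lim_seq (fun q => (e ** u) q / u q) l.
Proof.
  intros Hu HL; revert e; induction J as [|J IH]; intros e He.
  - exists 0; apply is_lim_seq_ext with (fun _ => 0); [|apply is_lim_seq_const].
    intros q; unfold PS_mult, Rdiv; rewrite sum_eq_R0; [ring|].
    intros; rewrite He by lia; ring.
  - destruct (IH (fun j => e (S j))) as [l Hl]; [intros; apply He; lia|].
    exists (e 0%nat + l * L); apply is_lim_seq_incr_1.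
    apply is_lim_seq_ext_loc with
      (fun q => e 0%nat + ((fun j => e (S j)) ** u) q / u q * (u q / u (S q))).
    + destruct Hu as [N HN]; exists N; intros q Hq; rewrite PS_mult_S_l.
      pose proof (HN q Hq); pose proof (HN (S q) ltac:(lia)); field; lra.
    + apply (is_lim_seq_plus' _ _ (e 0%nat) (l * L)); [apply is_lim_seq_const|].
      now apply is_lim_seq_mult'.
Qed.

Section Convolution.

Context (u B : nat -> R) (delta kappa L : R).
Context (delta_pos : 0 < delta) (kappa_pos : 0 < kappa).
Context (u_ge0 : forall q, 0 <= u q) (u_pos : eventually (fun q => 0 < u q)).

Local Notation c := (fun q => (delta * INR q + 1) * u q).

Context (B_ratio : is_lim_seq (fun q => B q / c q) kappa)
  (u_ratio : is_lim_seq (fun q => u q / u (S q)) L)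
  (u_eq : forall q, c q = (u ** B) q).

Lemma weight_ge0 (q : nat) : 0 <= c q.
Proof.
  apply Rmult_le_pos; [|apply u_ge0].
  pose proof (pos_INR q); nra.
Qed.

(** By symmetry, [u ** PS_theta u] is half of [PS_theta (u ** u)]. *)
Lemma PS_mult_weight (q : nat) : (u ** c) q = (delta * INR q / 2 + 1) * (u ** u) q.
Proof.
  rewrite (PS_mult_eq u u c (fun i => delta * PS_theta u i + u i) q)
    by (intros; unfold PS_theta; ring).
  rewrite PS_mult_plus_r, PS_mult_scal_r.
  pose proof (PS_theta_mult u u q) as H; rewrite (PS_mult_comm (PS_theta u)) in H.
  unfold PS_theta at 1 in H.
  replace ((u ** PS_theta u) q) with (INR q * (u ** u) q / 2) by lra.
  field.
Qed.

(** The finitely supported [e] absorbs the initial terms, where the ratio may be far from [kappa] or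
    [u] may vanish. *)
Lemma spine_approx (eps : R) :
  0 < eps -> exists e J, (forall j, (J <= j)%nat -> e j = 0) /\
  forall j, Rabs (B j - kappa * c j) <= eps * c j + e j.
Proof.
  intros Heps; apply is_lim_seq_Reals in B_ratio.
  destruct (B_ratio eps Heps) as [N1 H1]; destruct u_pos as [N2 H2].
  exists (fun j => if Nat.ltb j (N1 + N2) then Rabs (B j - kappa * c j) else 0), (N1 + N2)%nat.
  split; [intros j Hj; destruct (Nat.ltb_spec j (N1 + N2)); [lia|reflexivity]|].
  intros j; destruct (Nat.ltb_spec j (N1 + N2)) as [Hj|Hj].
  - pose proof (weight_ge0 j); simpl in *; nra.
  - specialize (H1 j ltac:(lia)); specialize (H2 j ltac:(lia)).
    unfold Rdist in H1.
    assert (Hc : 0 < c j) by (pose proof (pos_INR j); apply Rmult_lt_0_compat; nra).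
    cbv beta in *; set (cj := (delta * INR j + 1) * u j) in *.
    replace (B j - kappa * cj) with ((B j / cj - kappa) * cj) by (field; lra).
    rewrite Rabs_mult, (Rabs_right cj) by lra; nra.
Qed.

(** Replacing [B] by [kappa * c] in [c = u ** B] gives [|1 - kappa x| <= eps' x + y], where [x] is
    the ratio in question. The term [y] comes from [e] and tends to 0, as [e ** u] is of order at
    most [u] and [c] is larger by a linear factor. *)
Lemma weighted_convolution_ratio : is_lim_seq (fun q => (u ** c) q / c q) (/ kappa).
Proof.
  apply is_lim_seq_Reals; intros eps Heps.
  (* The first bound yields [kappa * x <= 4]; with it, the second yields
     [eps' * x <= eps * kappa / 4]. *)
  set (eps' := Rmin (kappa / 2) (eps * kappa * kappa / 16)).
  assert (Heps' : 0 < eps').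
  { apply Rmin_pos; [lra|]; repeat apply Rmult_lt_0_compat; lra. }
  destruct (spine_approx eps' Heps') as [e [J [He HeJ]]].
  destruct (PS_mult_finite_ratio u e L J u_pos u_ratio He) as [l Hl].
  assert (Hdelta : is_lim_seq (fun q => (e ** u) q / u q * / (delta * INR q + 1)) (l * 0)).
  { apply is_lim_seq_mult'; [exact Hl|now apply is_lim_seq_inv_affine]. }
  rewrite Rmult_0_r in Hdelta; apply is_lim_seq_Reals in Hdelta.
  destruct (Hdelta (Rmin 1 (eps * kappa / 4))) as [N1 H1].
  { apply Rmin_pos; [lra|]; apply Rlt_gt; repeat apply Rmult_lt_0_compat; lra. }
  destruct u_pos as [N2 H2].
  exists (N1 + N2)%nat; intros q Hq.
  specialize (H1 q ltac:(lia)); specialize (H2 q ltac:(lia)).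
  unfold Rdist in *; rewrite Rminus_0_r in H1.
  assert (Hc : 0 < c q) by (pose proof (pos_INR q); apply Rmult_lt_0_compat; nra).
  set (x := (u ** c) q / c q) in *.
  assert (Hx0 : 0 <= x).
  { apply Rmult_le_pos; [|left; now apply Rinv_0_lt_compat].
    apply PS_mult_ge0; [exact u_ge0|exact weight_ge0]. }
  set (y := (e ** u) q / u q * / (delta * INR q + 1)) in *.
  assert (Hxy : Rabs (1 - kappa * x) <= eps' * x + y).
  { apply Rmult_le_reg_r with (c q); [exact Hc|].
    replace (Rabs (1 - kappa * x) * c q) with (Rabs ((u ** B) q - kappa * (u ** c) q)).
    2:{ transitivity (Rabs (1 - kappa * x) * Rabs (c q)); [|now rewrite (Rabs_right (c q)) by lra].
        rewrite <- Rabs_mult; f_equal.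
        rewrite <- u_eq; unfold x; cbv beta in *; field; nra. }
    replace ((eps' * x + y) * c q) with (eps' * (u ** c) q + (u ** e) q).
    2:{ rewrite (PS_mult_comm u e); unfold x, y; cbv beta in *; field.
        pose proof (pos_INR q); split; nra. }
    rewrite <- !PS_mult_scal_r, <- PS_mult_plus_r.
    replace ((u ** B) q - (u ** (fun i => kappa * c i)) q)
      with ((u ** (fun j => B j - kappa * c j)) q).
    2:{ rewrite (PS_mult_eq u u (fun j => B j - kappa * c j)
          (fun j => B j + (-1) * (kappa * c j)) q) by (intros; ring).
        rewrite PS_mult_plus_r, PS_mult_scal_r; ring. }
    eapply Rle_trans; [apply Rabs_triang_gen|].
    apply sum_Rle; intros i _; rewrite Rabs_mult, (Rabs_right (u i)) by (apply Rle_ge, u_ge0).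
    apply Rmult_le_compat_l; [apply u_ge0|apply HeJ]. }
  assert (Hy : y < 1 /\ y < eps * kappa / 4).
  { pose proof (Rmin_l 1 (eps * kappa / 4)); pose proof (Rmin_r 1 (eps * kappa / 4)).
    pose proof (Rle_abs y); lra. }
  assert (He1 : eps' <= kappa / 2) by apply Rmin_l.
  assert (He2 : eps' <= eps * kappa * kappa / 16) by apply Rmin_r.
  assert (Hx4 : kappa * x <= 4).
  { pose proof (Rle_abs (- (1 - kappa * x))) as H; rewrite Rabs_Ropp in H.
    assert (eps' * x <= kappa / 2 * x) by now apply Rmult_le_compat_r.
    lra. }
  apply Rmult_lt_reg_l with kappa; [exact kappa_pos|].
  replace (kappa * Rabs (x - / kappa)) with (Rabs (1 - kappa * x)).
  2:{ rewrite <- (Rabs_right kappa) at 2 by lra; rewrite <- Rabs_mult.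
      rewrite <- Rabs_Ropp; f_equal; field; lra. }
  eapply Rle_lt_trans; [exact Hxy|].
  assert (eps' * x <= eps * kappa * kappa / 16 * x) by now apply Rmult_le_compat_r.
  assert (eps * kappa / 16 * (kappa * x) <= eps * kappa / 16 * 4).
  { apply Rmult_le_compat_l; [|exact Hx4].
    left; unfold Rdiv; repeat apply Rmult_lt_0_compat; lra. }
  assert (0 < eps * kappa) by (apply Rmult_lt_0_compat; lra).
  lra.
Qed.

Lemma convolution_ratio : is_lim_seq (fun q => (u ** u) q / u q) (2 / kappa).
Proof.
  (* The last factor is [(delta * q + 1) / (delta * q / 2 + 1)], from [PS_mult_weight]. *)
  apply is_lim_seq_ext_loc with
    (fun q => (u ** c) q / c q * (2 - / (delta / 2 * INR q + 1))).
  - destruct u_pos as [N HN]; exists N; intros q Hq; specialize (HN q Hq).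
    rewrite PS_mult_weight; cbv beta; field; pose proof (pos_INR q).
    repeat split; nra.
  - replace (2 / kappa) with (/ kappa * (2 - 0)) by (field; lra).
    apply is_lim_seq_mult'; [exact weighted_convolution_ratio|].
    apply is_lim_seq_minus'; [apply is_lim_seq_const|].
    apply is_lim_seq_inv_affine; lra.
Qed.

End Convolution.

(** * Asymptotics *)

Lemma exp_le_compat (x y : R) : x <= y -> exp x <= exp y.
Proof.
  intros [H|<-]; [left; now apply exp_increasing|apply Rle_refl].
Qed.

Lemma sum_f_R0_multiples (f : nat -> R) (d q : nat) :
  d <> 0%nat -> (forall i, f i <> 0 -> Nat.divide d i) ->
  sum_f_R0 f (d * q) = sum_f_R0 (fun i => f (d * i)%nat) q.
Proof.
  intros Hd Hf; induction q as [|q IH]; [simpl; now rewrite Nat.mul_0_r|].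
  rewrite tech5, <- IH.
  assert (Hj : forall j, (j < d)%nat -> sum_f_R0 f (d * q + j) = sum_f_R0 f (d * q)).
  { induction j as [|j IHj]; intros Hj; [now rewrite Nat.add_0_r|].
    rewrite Nat.add_succ_r, tech5, IHj by lia.
    enough (f (S (d * q + j)) = 0) by lra.
    apply NNPP; intros H; apply Hf in H; destruct H as [x Hx].
    rewrite (Nat.mul_comm x) in Hx.
    assert (d * q < d * x)%nat as H1 by lia.
    assert (d * x < d * S q)%nat as H2 by (rewrite Nat.mul_succ_r; lia).
    apply Nat.mul_lt_mono_pos_l in H1; [|lia]; apply Nat.mul_lt_mono_pos_l in H2; lia. }
  replace (d * S q)%nat with (S (d * q + (d - 1))) by lia.
  rewrite tech5, Hj by lia; reflexivity.
Qed.

Lemma PS_mult_multiples (a b : nat -> R) (d q : nat) :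
  d <> 0%nat -> (forall i, a i <> 0 -> Nat.divide d i) ->
  (a ** b) (d * q)%nat = ((fun i => a (d * i)%nat) ** (fun i => b (d * i)%nat)) q.
Proof.
  intros Hd Ha; unfold PS_mult; rewrite sum_f_R0_multiples; [|exact Hd|].
  - apply sum_eq; intros i Hi; now rewrite Nat.mul_sub_distr_l.
  - intros i Hi; apply Ha; intros E; apply Hi; rewrite E; ring.
Qed.

Lemma filterlim_eventually_mod (f : nat -> R) (r d : nat) (l : R) :
  d <> 0%nat -> is_lim_seq (fun q => f (r + d * q)%nat) l ->
  filterlim f (eventually_mod r d) (locally l).
Proof.
  intros Hd Hf P HP; destruct (Hf P HP) as [N HN].
  exists (r + d * N)%nat; intros n Hn Hmod.
  replace n with (r + d * ((n - r) / d))%nat.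
  - apply HN, Nat.div_le_lower_bound; lia.
  - pose proof (Nat.div_mod n d Hd); pose proof (Nat.div_mod r d Hd).
    set (x := (n / d)%nat) in *; set (y := (r / d)%nat) in *.
    replace (n - r)%nat with ((x - y) * d)%nat by nia.
    rewrite Nat.div_mul by exact Hd; nia.
Qed.

Section Asymptotics.

Context (Z omega : nat -> R) (d : nat).
Context (Z_ge0 : forall n, 0 <= Z n) (omega_ge0 : forall k, 0 <= omega k)
  (Z_0 : Z 0%nat = 0) (Z_eq : forall n, Z n = PS_incr_1 (PS_comp omega Z) n)
  (omega_0 : 0 < omega 0%nat) (omega_k : exists k, (2 <= k)%nat /\ 0 < omega k)
  (d_gcd : is_support_gcd omega d).
Context (rho : R) (radius_rho : CV_radius Z = Finite rho) (rho_pos : 0 < rho).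

Local Notation tau := (PSeries Z rho).
Local Notation b := (spine_series Z omega).

Lemma d_neq0 : d <> 0%nat.
Proof. exact (gcd_pos omega d omega_k d_gcd). Qed.

Lemma INR_d_pos : 0 < INR d.
Proof. apply lt_0_INR; pose proof d_neq0; lia. Qed.

Lemma ex_pseries_rho : ex_pseries Z rho.
Proof. eapply ex_pseries_at_radius; eauto; now rewrite radius_rho. Qed.

Lemma tau_pos : 0 < tau.
Proof.
  destruct omega_k as [k [Hk Hw]].
  destruct (tree_value_bound Z omega Z_ge0 omega_ge0 Z_0 Z_eq omega_0 k rho) as [H _];
    auto using ex_pseries_rho.
  eapply Rlt_le_trans; [|exact H]; now apply Rmult_lt_0_compat.
Qed.

Lemma omega_eval_le (K : nat) : rho * PS_eval K omega tau <= tau.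
Proof.
  apply (tree_value_ge Z omega Z_ge0 omega_ge0 Z_0 Z_eq); [lra|].
  apply is_lim_seq_PS_eval, ex_pseries_rho.
Qed.

(** * Density of the fringe subtrees of a fixed size *)

Section Fringe.

Context (s : nat) (s_pos : (1 <= s)%nat) (Zs_pos : 0 < Z s).

Local Notation p := (Z s * rho ^ s / tau).
Local Notation E := (PS_mono s (Z s) ** b).

(** The logarithm of the Chernoff bound at [r = rho * exp (- (a * t))], where [Z n] is bounded below
    by [tree_growth] at the rate [exp (- eta) / rho]. *)
Lemma fringe_exponent (t a eta : R) :
  0 < eta ->
  exp (- (a * t)) + (exp t - 1) * p * exp (- (a * t)) ^ s <= 1 ->
  PS_eval (s - 1) Z (rho * exp (- (a * t))) <= tau ->
  exists C N, forall q, (N <= q)%nat ->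
    t * (E (S (d * q)) / Z (S (d * q))) <= C + INR (S (d * q)) * (a * t + eta).
Proof.
  intros Heta H1 H0; pose proof tau_pos as Htau.
  set (r := rho * exp (- (a * t))) in *.
  assert (Hr : 0 < r) by (apply Rmult_lt_0_compat; [exact rho_pos|apply exp_pos]).
  assert (Hir : 0 < / rho) by now apply Rinv_0_lt_compat.
  set (q0 := / rho * exp (- eta)).
  assert (Hq0 : 0 < q0 < / rho).
  { split; [apply Rmult_lt_0_compat; [exact Hir|apply exp_pos]|].
    rewrite <- (Rmult_1_r (/ rho)); apply Rmult_lt_compat_l; [exact Hir|].
    rewrite <- exp_0; apply exp_increasing; lra. }
  destruct (tree_growth Z omega d Z_ge0 omega_ge0 Z_0 Z_eq omega_0 omega_k d_gcd
    rho q0 radius_rho rho_pos Hq0) as [c [N [Hc HN]]].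
  (* The growth bound has exponent [d * q] and the Chernoff bound [S (d * q)], so one factor [rho]
     survives. *)
  exists (ln (tau / (c * rho))), N; intros q Hq; specialize (HN q Hq).
  set (x := t * (E (S (d * q)) / Z (S (d * q)))).
  assert (HK : forall K, r * PS_eval K omega tau + (exp t - 1) * Z s * r ^ s <= tau).
  { intros K; unfold r at 2; rewrite Rpow_mult_distr.
    assert (r * PS_eval K omega tau <= exp (- (a * t)) * tau).
    { unfold r; rewrite (Rmult_comm rho), Rmult_assoc.
      apply Rmult_le_compat_l; [left; apply exp_pos|apply omega_eval_le]. }
    replace ((exp t - 1) * Z s * (rho ^ s * exp (- (a * t)) ^ s))
      with (((exp t - 1) * p * exp (- (a * t)) ^ s) * tau) by (field; lra).
    apply Rmult_le_compat_r with (r := tau) in H1; lra. }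
  pose proof (fringe_chernoff Z omega Z_ge0 omega_ge0 Z_0 Z_eq s s_pos t r tau
    (S (d * q)) ltac:(lra) ltac:(lra) H0 HK) as Hch; fold x in Hch.
  set (n := S (d * q)) in *.
  assert (Hle : c * q0 ^ (d * q) * (exp x * r ^ n) <= tau).
  { eapply Rle_trans; [|exact Hch]; rewrite (Rmult_assoc (Z n)).
    apply Rmult_le_compat_r; [|exact HN].
    apply Rmult_le_pos; [left; apply exp_pos|apply pow_le; lra]. }
  assert (Hexp : exp (x - INR n * (a * t + eta)) <= tau / (c * rho)).
  { apply Rmult_le_reg_r with (c * rho); [now apply Rmult_lt_0_compat|].
    unfold Rdiv at 1; rewrite Rmult_assoc, Rinv_l, Rmult_1_r
      by (apply Rgt_not_eq, Rmult_lt_0_compat; lra).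
    eapply Rle_trans; [|exact Hle].
    unfold q0, r; rewrite !Rpow_mult_distr, !exp_pow_nat, pow_inv.
    replace (rho ^ n) with (rho * rho ^ (d * q)) by reflexivity.
    replace (c * (/ rho ^ (d * q) * exp (INR (d * q) * - eta)) *
      (exp x * (rho * rho ^ (d * q) * exp (INR n * - (a * t)))))
      with (exp (INR (d * q) * - eta) * exp x * exp (INR n * - (a * t)) * (c * rho))
      by (field; apply pow_nonzero; lra).
    rewrite <- !exp_plus; apply Rmult_le_compat_r; [left; now apply Rmult_lt_0_compat|].
    apply exp_le_compat; unfold n; rewrite S_INR; lra. }
  assert (x - INR n * (a * t + eta) <= ln (tau / (c * rho))).
  { rewrite <- (ln_exp (x - INR n * (a * t + eta))).
    destruct Hexp as [Hexp|<-]; [left; apply ln_increasing; [apply exp_pos|exact Hexp]|lra]. }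
  lra.
Qed.

(** The sign [sigma] selects upper or lower deviations. Taking [t = sigma * h] and
    [a = p + sigma * (eps / 3)] makes [(p - a) * t] negative, as the tilt requires. *)
Lemma fringe_deviation (sigma eps : R) :
  sigma * sigma = 1 -> 0 < eps ->
  exists N, forall q, (N <= q)%nat ->
    sigma * (E (S (d * q)) / (INR (S (d * q)) * Z (S (d * q))) - p) < eps.
Proof.
  intros Hsigma Heps; pose proof tau_pos as Htau.
  set (a := p + sigma * (eps / 3)).
  assert (Hs0 : sigma <> 0) by (intros ->; lra).
  pose proof (is_derive_decrease _ _ (is_derive_tilt p a s)) as H1.
  assert (Ha : p - a <> 0).
  { unfold a; replace (p - (p + sigma * (eps / 3))) with (- (sigma * (eps / 3))) by ring.
    apply Ropp_neq_0_compat, Rmult_integral_contrapositive; split; lra. }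
  specialize (H1 Ha).
  assert (H0 : locally 0 (fun t => PS_eval (s - 1) Z (rho * exp (- (a * t))) < tau)).
  { assert (Hc : continuous (fun t => PS_eval (s - 1) Z (rho * exp (- (a * t)))) 0).
    { apply (continuous_comp (fun t => rho * exp (- (a * t))) (PS_eval (s - 1) Z)).
      - apply (ex_derive_continuous (fun t => rho * exp (- (a * t)))); auto_derive; exact I.
      - apply continuous_PS_eval. }
    refine (Hc _ (open_lt tau _ _)).
    rewrite Rmult_0_r, Ropp_0, exp_0, Rmult_1_r.
    (* The missing term [Z s * rho ^ s] makes the inequality strict at [t = 0], hence stable for
       small [t]. *)
    apply Rlt_le_trans with (PS_eval s Z rho).
    - destruct s as [|s']; [lia|]; unfold PS_eval; rewrite (tech5 _ s').
      replace (S s' - 1)%nat with s' by lia.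
      pose proof (Rmult_lt_0_compat _ _ Zs_pos (pow_lt rho (S s') rho_pos)); lra.
    - apply PS_eval_le_PSeries; auto using ex_pseries_rho; lra. }
  destruct (filter_and _ _ H1 H0) as [[del Hdel] Hloc].
  set (h := del / 2); set (t := sigma * h).
  assert (Hh : 0 < h) by (unfold h; lra).
  assert (Habs : Rabs sigma = 1).
  { pose proof (Rabs_pos sigma).
    assert (Rabs sigma * Rabs sigma = 1) by (rewrite <- Rabs_mult, Hsigma; apply Rabs_R1).
    nra. }
  destruct (Hloc t) as [Ht1 Ht0].
  { change (Rabs (t - 0) < del); rewrite Rminus_0_r; unfold t.
    rewrite Rabs_mult, Habs, (Rabs_right h); unfold h; lra. }
  assert (Hneg : (p - a) * t < 0).
  { unfold a, t; replace ((p - (p + sigma * (eps / 3))) * (sigma * h))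
      with (- ((sigma * sigma) * (eps / 3 * h))) by ring.
    rewrite Hsigma; assert (0 < eps / 3 * h) by (apply Rmult_lt_0_compat; lra); lra. }
  specialize (Ht1 Hneg); rewrite Rmult_0_r, Ropp_0, exp_0 in Ht1.
  (* The error has three parts, each at most [eps / 3] after division by [n * h]: the shift of [a],
     the loss [eta], and the constant [C]. *)
  destruct (fringe_exponent t a (h * (eps / 3))) as [C [N HN]].
  { apply Rmult_lt_0_compat; lra. }
  { lra. }
  { lra. }
  destruct (INR_unbounded (C / (h * (eps / 3)))) as [N' HN'].
  destruct (tree_pos_large Z omega d Z_ge0 omega_ge0 Z_0 Z_eq omega_0 omega_k d_gcd)
    as [N'' HN''].
  exists (N + N' + N'')%nat; intros q Hq; specialize (HN q ltac:(lia)).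
  specialize (HN'' q ltac:(lia)).
  set (n := S (d * q)) in *.
  assert (Hn : C < INR n * (h * (eps / 3))).
  { assert (INR N' <= INR n) by (apply le_INR; pose proof d_neq0; unfold n; nia).
    assert (0 < h * (eps / 3)) by (apply Rmult_lt_0_compat; lra).
    apply Rmult_gt_compat_r with (r := h * (eps / 3)) in HN'; [|assumption].
    replace (C / (h * (eps / 3)) * (h * (eps / 3))) with C in HN' by (field; lra).
    assert (INR N' * (h * (eps / 3)) <= INR n * (h * (eps / 3)))
      by (apply Rmult_le_compat_r; lra).
    lra. }
  assert (Hn0 : 0 < INR n) by (apply lt_0_INR; unfold n; lia).
  replace (E n / (INR n * Z n)) with (E n / Z n / INR n) by (field; lra).
  set (x := E n / Z n) in *.
  apply Rmult_lt_reg_l with (INR n * h); [now apply Rmult_lt_0_compat|].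
  replace (INR n * h * (sigma * (x / INR n - p)))
    with (t * x - INR n * (sigma * h * p)) by (unfold t; field; lra).
  replace (a * t) with (sigma * h * p + (sigma * sigma) * (h * (eps / 3))) in HN
    by (unfold a, t; ring).
  rewrite Hsigma, Rmult_1_l in HN; lra.
Qed.

Lemma fringe_ratio :
  is_lim_seq (fun q => E (S (d * q)) / (INR (S (d * q)) * Z (S (d * q)))) p.
Proof.
  apply is_lim_seq_Reals; intros eps Heps.
  destruct (fringe_deviation 1 eps) as [N HN]; [ring|exact Heps|].
  destruct (fringe_deviation (-1) eps) as [N' HN']; [ring|exact Heps|].
  exists (N + N')%nat; intros q Hq; specialize (HN q ltac:(lia)); specialize (HN' q ltac:(lia)).
  apply Rabs_def1; lra.
Qed.

End Fringe.

(** * Limits of the ratios and of the convolution *)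

Local Notation u := (fun q => Z (S (d * q))).
Local Notation c := (fun q => (INR d * INR q + 1) * Z (S (d * q))).

Lemma tree_weight (q : nat) : INR (S (d * q)) * Z (S (d * q)) = c q.
Proof. now rewrite S_INR, mult_INR. Qed.

Lemma u_eventually_pos : eventually (fun q => 0 < u q).
Proof. exact (tree_pos_large Z omega d Z_ge0 omega_ge0 Z_0 Z_eq omega_0 omega_k d_gcd). Qed.

(** Fringe subtrees of size [S (d * j)] in trees of size [S (d * (q + j))] leave the degree [d * q]
    to the spine. *)
Lemma spine_ratio (j : nat) :
  0 < Z (S (d * j)) ->
  is_lim_seq (fun q => b (d * q)%nat / c (q + j)%nat) (rho ^ S (d * j) / tau).
Proof.
  intros Hj; pose proof tau_pos.
  pose proof (fringe_ratio (S (d * j)) ltac:(lia) Hj) as H1.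
  apply (is_lim_seq_incr_n _ j) in H1.
  apply (is_lim_seq_scal_l _ (/ Z (S (d * j)))) in H1.
  replace (rho ^ S (d * j) / tau)
    with (/ Z (S (d * j)) * (Z (S (d * j)) * rho ^ S (d * j) / tau)) by (field; lra).
  eapply is_lim_seq_ext; [|exact H1].
  intros q; cbv beta; rewrite tree_weight, PS_mult_mono.
  destruct (Nat.ltb_spec (S (d * (q + j))) (S (d * j))); [nia|].
  replace (S (d * (q + j)) - S (d * j))%nat with (d * q)%nat by nia.
  unfold Rdiv; rewrite !Rmult_assoc, <- Rmult_assoc, Rinv_l by lra; ring.
Qed.

(** For two fringe sizes that differ by [d], both of positive weight, the same [b (d * q)] appears
    in [spine_ratio] and cancels in the quotient. *)
Lemma tree_ratio : is_lim_seq (fun q => u q / u (S q)) (rho ^ d).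
Proof.
  pose proof tau_pos as Htau; pose proof INR_d_pos as Hd.
  destruct (tree_pos_pair Z omega d Z_ge0 omega_ge0 Z_0 Z_eq omega_0 omega_k d_gcd)
    as [k [Hk Hkd]].
  destruct (tree_pos_divide Z omega d omega_ge0 Z_0 Z_eq d_gcd k Hk) as [j ->].
  rewrite (Nat.mul_comm j) in Hk, Hkd.
  replace (d * j + d)%nat with (d * S j)%nat in Hkd by lia.
  pose proof (spine_ratio j Hk) as H1; pose proof (spine_ratio (S j) Hkd) as H2.
  assert (Hl1 : 0 < rho ^ S (d * j) / tau) by (apply Rdiv_lt_0_compat; auto using pow_lt).
  pose proof (is_lim_seq_pos _ _ H1 Hl1) as Hpos.
  pose proof (is_lim_seq_div' _ _ _ _ H2 H1 ltac:(lra)) as H3.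
  apply (is_lim_seq_incr_n _ j).
  replace (rho ^ d) with ((rho ^ S (d * S j) / tau) / (rho ^ S (d * j) / tau) * (1 + INR d * 0)).
  2:{ replace (S (d * S j)) with (d + S (d * j))%nat by lia; rewrite pow_add; field.
      split; [|apply pow_nonzero]; lra. }
  (* The quotient of the sizes [n + d] and [n], for [n = d * (q + j) + 1], converts [c] back into
     [u]. *)
  assert (H4 : is_lim_seq (fun q => 1 + INR d * / (INR d * INR q + (INR d * INR j + 1)))
                 (1 + INR d * 0)).
  { apply (is_lim_seq_plus' _ _ 1 (INR d * 0)); [apply is_lim_seq_const|].
    apply is_lim_seq_mult'; [apply is_lim_seq_const|now apply is_lim_seq_inv_affine]. }
  eapply is_lim_seq_ext_loc; [|exact (is_lim_seq_mult' _ _ _ _ H3 H4)].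
  destruct u_eventually_pos as [N HN]; destruct Hpos as [N' HN'].
  exists (N + N')%nat; intros q Hq.
  specialize (HN' q ltac:(lia)).
  pose proof (HN (q + j)%nat ltac:(lia)) as Hu; pose proof (HN (S (q + j)) ltac:(lia)) as Hu'.
  assert (Hb : b (d * q)%nat <> 0).
  { intros E; rewrite E in HN'; unfold Rdiv in HN'; rewrite Rmult_0_l in HN'; lra. }
  replace (q + S j)%nat with (S (q + j)) by lia.
  cbv beta in *; rewrite S_INR, plus_INR.
  pose proof (pos_INR q); pose proof (pos_INR j).
  field; repeat split; try lra; nra.
Qed.

Lemma tree_S_support (i : nat) : Z (S i) <> 0 -> Nat.divide d i.
Proof.
  intros Hi; destruct (tree_support Z omega d omega_ge0 Z_0 Z_eq d_gcd _ Hi) as [q Hq].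
  exists q; lia.
Qed.

Lemma tree_convolution_ratio :
  is_lim_seq (fun q => ((fun i => Z (S i)) ** (fun i => Z (S i))) (d * q)%nat / u q)
    (2 * tau / rho).
Proof.
  pose proof tau_pos as Htau; pose proof d_neq0 as Hd.
  replace (2 * tau / rho) with (2 / (rho / tau)) by (field; lra).
  apply is_lim_seq_ext with (fun q => (u ** u) q / u q).
  { intros q; rewrite PS_mult_multiples; auto using tree_S_support. }
  apply (convolution_ratio u (fun q => b (d * q)%nat) (INR d) (rho / tau) (rho ^ d)).
  - exact INR_d_pos.
  - now apply Rdiv_lt_0_compat.
  - auto.
  - exact u_eventually_pos.
  - pose proof (spine_ratio 0) as H; rewrite Nat.mul_0_r in H; simpl pow in H.
    rewrite Rmult_1_r in H.
    eapply is_lim_seq_ext; [|apply H; rewrite tree_1 with (omega := omega); auto].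
    intros q; cbv beta; now rewrite Nat.add_0_r.
  - exact tree_ratio.
  (* This is [PS_theta Z = Z ** b] in degree [S (d * q)]; as [Z 0 = 0], the factor [Z] can be
     shifted by one. *)
  - intros q; rewrite <- tree_weight.
    change (PS_theta Z (S (d * q)) = (u ** (fun q => b (d * q)%nat)) q).
    rewrite (PS_theta_tree Z omega Z_0 Z_eq), PS_mult_S_l, Z_0, Rmult_0_l, Rplus_0_l.
    apply PS_mult_multiples; auto using tree_S_support.
Qed.

End Asymptotics.

Theorem lemma3p3 (Z omega : nat -> R) (d : nat)
  (Z_ge0 : forall n, 0 <= Z n)
  (omega_ge0 : forall k, 0 <= omega k)
  (Z_0 : Z 0%nat = 0)
  (Z_eq : forall n, Z n = PS_incr_1 (PS_comp omega Z) n)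
  (omega_0 : 0 < omega 0%nat)
  (omega_k : exists k, (2 <= k)%nat /\ 0 < omega k)
  (d_gcd : is_support_gcd omega d)
  (radius_Z : Rbar_lt 0 (CV_radius Z)) :
  (exists rho : R,
    CV_radius Z = Finite rho /\
    ex_pseries Z rho /\
    filterlim (fun n => / Z n * PS_mult Z Z (n + 1)%nat)
      (eventually_mod 1 d) (locally (2 * PSeries Z rho / rho))) /\
  in_class_S d (PS_decr_1 Z).
Proof.
  destruct (tree_radius_finite Z omega Z_ge0 omega_ge0 Z_0 Z_eq omega_0 omega_k radius_Z)
    as [rho [Erho Hrho]].
  pose proof (gcd_pos omega d omega_k d_gcd) as Hd.
  assert (Hex : ex_pseries Z rho) by (eapply ex_pseries_rho; eauto).
  assert (Hconv := tree_convolution_ratio Z omega d Z_ge0 omega_ge0 Z_0 Z_eq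
    omega_0 omega_k d_gcd rho Erho Hrho).
  split.
  - exists rho; split; [exact Erho|]; split; [exact Hex|].
    apply filterlim_eventually_mod; [exact Hd|].
    eapply is_lim_seq_ext; [|exact Hconv].
    intros q; simpl Nat.add; rewrite Nat.add_1_r.
    (* The two extreme terms of the sum over [i + j = n + 1] contain [Z 0 = 0]; the others form the
       convolution square of the shifted series. *)
    rewrite PS_mult_S_l, PS_mult_S_r, Z_0; unfold Rdiv; ring.
  - split; [lia|]; split; [intros n; apply Z_ge0|].
    exists rho; rewrite CV_radius_decr_1; repeat (split; [assumption|]).
    split; [|split; [|split]].
    + intros n Hn; apply NNPP; intros H; apply Hn.
      eapply tree_S_support; eauto.
    + apply filterlim_eventually_mod; [exact Hd|].
      eapply is_lim_seq_ext; [|eapply (tree_ratio Z omega d); eauto].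
      intros q; unfold PS_decr_1; simpl Nat.add.
      now replace (d * S q)%nat with (d * q + d)%nat by lia.
    + apply ex_pseries_decr_1; [|exact Hex].
      right; exists (/ rho); apply Rinv_l; lra.
    + apply filterlim_eventually_mod; [exact Hd|].
      (* As [Z(rho)] is [rho] times the value of the shifted series, the factor [rho] cancels in the
         limit. *)
      rewrite (PSeries_decr_1_aux Z rho Z_0) in Hconv.
      replace (2 * PSeries (PS_decr_1 Z) rho)
        with (2 * (rho * PSeries (PS_decr_1 Z) rho) / rho) by (field; lra).
      eapply is_lim_seq_ext; [|exact Hconv].
      intros q; unfold Rdiv; rewrite Rmult_comm; reflexivity.
Qed.
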